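(* Let $\phi=\tilde p/p$ satisfy (A1) and suppose $\mathcal{V}$ is an open set containing $(1,1)$ such that $\mathcal{Z}_{\tilde p}\cap\mathcal{V}$ is described by its branches $z_1=\psi^0_1(z_2),\dots,z_1=\psi^0_{L_0}(z_2)$. Then $$N_{(1,1)}(p,\tilde p)\le\sum_{i=1}^{L_0}\sum_{j=1}^{L_0}\min\{\mathcal{K}^1_i,\mathcal{K}^1_j\},$$ where $\mathcal{K}^1_i$ is the $z_1$-contact order of the branch $z_1=\psi^0_i(z_2)$ at $(1,1)$, $i=1,\dots,L_0$.
   Context: $\mathbb{D}$ is the open unit disk, $\mathbb{T}$ the unit circle, $\Pi$ the open upper half-plane, $\beta(w)=\frac{1+iw}{1-iw}$ (a conformal map $\Pi\to\mathbb{D}$), $\beta^{-1}(z)=i\frac{1-z}{1+z}$. For a polynomial $p\in\mathbb{C}[z_1,z_2]$ of bidegree $(m,n)$, its reflection is $\tilde p(z_1,z_2)=z_1^mz_2^n\overline{p(1/\bar z_1,1/\bar z_2)}$. A rational inner function (RIF) on $\mathbb{D}^2$ is a rational function that is holomorphic and bounded on $\mathbb{D}^2$ with $|\phi|=1$ a.e. on $\mathbb{T}^2$. We write $f\approx g$ if each of $f,g$ is bounded by a positive constant multiple of the other. $N_\tau(p,\tilde p)$ denotes the usual intersection multiplicity of the polynomials $p$ and $\tilde p$ at a common zero $\tau$. (A1): $\phi=\tilde p/p$ is an RIF on $\mathbb{D}^2$, where $p$ has no zeros in $\mathbb{D}^2$ and $p,\tilde p$ have no common factor; $\phi$ has a singularity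 at $(1,1)$ (i.e. $p(1,1)=0$, hence also $\tilde p(1,1)=0$); and the non-tangential value of $\phi$ at $(1,1)$ is $1$. Branches of the zero set $\mathcal{Z}_{\tilde p}=\{\tilde p=0\}$. Let $q(w_1,w_2)=(1-iw_1)^m(1-iw_2)^n\tilde p(\beta(w_1),\beta(w_2))$. Near $(0,0)$ factor $q=\alpha q_1\cdots q_L$ with $\alpha$ a unit and $q_k$ (not necessarily distinct) irreducible Weierstrass polynomials in $w_1$ of degree $N_k$; the zero set of $q_k$ is given by a Puiseux series $w_1=\Psi^0_k(w_2^{1/N_k})$ with $\Psi_k^0$ a convergent power series, $\Psi^0_k(0)=0$. Choosing, for each $k$, the $N_k$ branches of the root with discontinuity only on $(-\infty,0]$, one gets $L_0=N_1+\dots+N_L$ functions $\psi^0_\ell(z_2)=\beta\big(\Psi^0_k(\beta^{-1}(z_2)^{1/N_k})\big)$ (so branches are listed according to the multiplicities of the Weierstrass factors); the curves $z_1=\psi^0_\ell(z_2)$ are the branches of $\mathcal{Z}_{\tilde p}$ near $(1,1)$. The $z_1$-contact order of a branch is the even number $\mathcal{K}^1_\ell$ with $1-|\psi^0_\ell(\zeta_2)|\approx|1-\zeta_2|^{\mathcal{K}^1_\ell}$ for $\zeta_2\in\mathbb{T}$ close to $1$ (it exists). *)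

(* Defs.v *)
From HB Require Import structures.
From mathcomp Require Import all_boot all_order all_algebra.
From mathcomp Require Import complex.
From mathcomp Require Import ring.
From mathcomp Require Import all_classical all_reals all_analysis.

Set Implicit Arguments.
Unset Strict Implicit.
Unset Printing Implicit Defensive.

Import Order.TTheory GRing.Theory Num.Theory.
Import numFieldNormedType.Exports.

Local Open Scope classical_set_scope.
Local Open Scope ring_scope.

(* A polynomial in C[z1, z2] is a term of type {poly {poly C}} in which the
   outer variable is z1 and the inner one is z2, so that p.[z1, z2] is its
   value, size p is 1 + deg_{z1} p and sizeY p is 1 + deg_{z2} p (p != 0).
   The regular module R[i]^o carries the usual topology of the complex plane,
   and the norm of R[i]^o * R[i]^o is max(|z1|, |z2|). *)

Section Algebra.
Variable F : fieldType.
Implicit Types p q : {poly {poly F}}.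

Definition bidegree p (m n : nat) : Prop := size p = m.+1 /\ sizeY p = n.+1.

Definition no_common_factor p q : Prop :=
  forall d a b : {poly {poly F}}, p = d * a -> q = d * b -> d \is a GRing.unit.

Notation "x %:F" := (@FracField.tofrac {poly {poly F}} x) : ring_scope.

Definition local_ring (a b : F) : set {fraction {poly {poly F}}} :=
  [set x | exists f g : {poly {poly F}}, g.[a, b] != 0 /\ x = f%:F / g%:F].

Definition local_ideal p q (a b : F) : set {fraction {poly {poly F}}} :=
  [set x | exists u v, local_ring a b u /\ local_ring a b v /\
                       x = u * p%:F + v * q%:F].

(* N is the dimension over F of the quotient of the local ring at (a, b) by
   the ideal generated by p and q: the classes of e_0, ..., e_(N-1) form a
   basis of this quotient. *)
Definition intersection_multiplicity p q (a b : F) (N : nat) : Prop :=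
  exists e : 'I_N -> {fraction {poly {poly F}}},
    [/\ forall i, local_ring a b (e i),
        forall c : 'I_N -> F,
          local_ideal p q a b (\sum_(i < N) (c i)%:P%:P%:F * e i) ->
          forall i, c i = 0
      & forall x, local_ring a b x ->
          exists c : 'I_N -> F,
            local_ideal p q a b (x - \sum_(i < N) (c i)%:P%:P%:F * e i)].

End Algebra.

Section RationalInner.
Variable R : realType.
Local Notation C := R[i].
Implicit Types p q : {poly {poly C}}.

(* The coefficient of z1^i z2^j in the reflection is the conjugate of that of
   z1^(m-i) z2^(n-j) in p, see reflectionE. *)
Definition reflection (m n : nat) p : {poly {poly C}} :=
  \poly_(i < m.+1) \poly_(j < n.+1) (p`_(m - i)`_(n - j))^*.

Fact hornerXY_wide (m n : nat) p (z1 z2 : C) :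
  (size p <= m.+1)%N -> (sizeY p <= n.+1)%N ->
  p.[z1, z2] = \sum_(i < m.+1) \sum_(j < n.+1) p`_i`_j * z2 ^+ j * z1 ^+ i.
Proof.
move=> pm pn; rewrite (horner_coef_wide _ pm) horner_sum.
apply: eq_bigr => i _; rewrite -polyC_exp hornerM hornerC.
rewrite (@horner_coef_wide _ n.+1) ?mulr_suml//.
by rewrite (leq_trans _ pn)// max_size_coefXY.
Qed.

Lemma reflectionE (m n : nat) p (z1 z2 : C) :
  bidegree p m n -> z1 != 0 -> z2 != 0 ->
  (reflection m n p).[z1, z2]
  = z1 ^+ m * z2 ^+ n * (p.[(z1^*)^-1, (z2^*)^-1])^*.
Proof.
move=> [pm pn] z10 z20.
rewrite (@hornerXY_wide m n p) ?pm ?pn//.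
rewrite (@hornerXY_wide m n); first last.
- rewrite (leq_trans (_ : sizeY _ <= n.+1)%N)//.
  by apply/bigmax_leqP => i _; rewrite coef_poly; case: ifP => _;
    rewrite ?size_poly0// size_poly.
- exact: size_poly.
rewrite rmorph_sum mulr_sumr (reindex_inj rev_ord_inj); apply: eq_bigr => i _.
rewrite rmorph_sum mulr_sumr (reindex_inj rev_ord_inj); apply: eq_bigr => j _.
rewrite !(rmorphM, rmorphXn, fmorphV)/= !conjCK !coef_poly !ltnS !subSS.
rewrite !leq_subr coef_poly ltnS leq_subr !subKn -1?ltnS//.
have zB (z : C) k l : z != 0 -> (l <= k)%N -> z ^+ (k - l) = z ^+ k * z^-1 ^+ l.
  by move=> z0 lk; rewrite exprB ?unitfE// exprVn.
by rewrite !zB -1?ltnS//; ring.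
Qed.

Definition expi (t : R) : C := (cos t +i* sin t)%C.

Definition bidisk : set (C^o * C^o) :=
  [set z | `|z.1| < 1 /\ `|z.2| < 1].

Definition ratio p q (z : C^o * C^o) : C^o := p.[z.1, z.2] / q.[z.1, z.2].

Definition rational_function (phi : C^o * C^o -> C^o) : Prop :=
  exists p q, q != 0 /\
    forall z, q.[z.1, z.2] != 0 -> phi z = ratio p q z.

(* The torus is parametrized by the angles (t1, t2) in [0, 2 pi]^2. *)
Definition rational_inner (phi : C^o * C^o -> C^o) : Prop :=
  [/\ rational_function phi,
      forall z, bidisk z -> differentiable phi z,
      exists M : C, forall z, bidisk z -> `|phi z| <= M
    & {ae (@lebesgue_measure R \x @lebesgue_measure R)%E,
        forall t : R * R,
          0 <= t.1 <= 2 * pi -> 0 <= t.2 <= 2 * pi ->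
          `|phi (expi t.1, expi t.2)| = 1}].

(* The non-tangential approach regions at tau are the sets
   {z in D^2 : |z - tau| <= c (1 - |z|)}, |.| being the sup norm of C^2. *)
Definition nontangential_value (phi : C^o * C^o -> C^o) (tau : C^o * C^o)
    (l : C^o) : Prop :=
  forall c : C, 0 < c ->
    phi z @[z --> within
      [set z | bidisk z /\ `|z - tau| <= c * (1 - `|z|)] (nbhs tau)] --> l.

Record assumption_A1 (m n : nat) p : Prop := AssumptionA1 {
  A1_bidegree : bidegree p m n;
  A1_stable : forall z, bidisk z -> p.[z.1, z.2] != 0;
  A1_coprime : no_common_factor p (reflection m n p);
  A1_inner : rational_inner (ratio (reflection m n p) p);
  A1_singular : p.[1, 1] = 0;
  A1_value : nontangential_value (ratio (reflection m n p) p) (1, 1) 1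
}.

End RationalInner.

Section Branches.
Variable R : realType.
Local Notation C := R[i].

Definition beta (w : C) : C := (1 + 'i * w) / (1 - 'i * w).
Definition beta_inv (z : C) : C := 'i * (1 - z) / (1 + z).

Definition analytic_at0 (f : C -> C) : Prop :=
  exists c : nat -> C,
    \forall t \near (0 : C^o),
      series (fun k => c k * t ^+ k : C^o) @ \oo --> (f t : C^o).

(* The first clause is the absolute convergence of the double series. *)
Definition analytic_at00 (f : C -> C -> C) : Prop :=
  exists c : nat -> nat -> C,
    \forall w \near ((0, 0) : C^o * C^o),
      cvgn (fun d : nat => \sum_(j < d) \sum_(k < d)
              `|c j k * w.1 ^+ j * w.2 ^+ k| : C^o) /\
      (fun d : nat => \sum_(j < d) \sum_(k < d)
         c j k * w.1 ^+ j * w.2 ^+ k : C^o) @ \oo --> (f w.1 w.2 : C^o).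

(* Irreducibility of the germ of f in the ring of convergent power series in
   two variables, whose units are the germs that do not vanish at 0. *)
Definition irreducible_germ (f : C -> C -> C) : Prop :=
  f 0 0 = 0 /\
  forall g h, analytic_at00 g -> analytic_at00 h ->
    (\forall w \near ((0, 0) : C^o * C^o),
      f w.1 w.2 = g w.1 w.2 * h w.1 w.2) ->
    g 0 0 != 0 \/ h 0 0 != 0.

Definition weierstrass_polynomial (f : C -> C -> C) (N : nat) : Prop :=
  exists a : 'I_N -> C -> C,
    (forall j, analytic_at0 (a j) /\ a j 0 = 0) /\
    \forall w \near ((0, 0) : C^o * C^o),
      f w.1 w.2 = w.1 ^+ N + \sum_(j < N) a j w.2 * w.1 ^+ j.

(* The zero set of f near the origin is w1 = Psi (w2^(1/N)). *)
Definition puiseux_parametrization (f : C -> C -> C) (N : nat) (Psi : C -> C) :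
    Prop :=
  [/\ analytic_at0 Psi, Psi 0 = 0
    & \forall w \near ((0, 0) : C^o * C^o),
        f w.1 w.2 = 0 <-> exists t : C, t ^+ N = w.2 /\ w.1 = Psi t].

Definition puiseux_factorization (q : C -> C -> C) (L : nat) (N : 'I_L -> nat)
    (Psi : 'I_L -> C -> C) : Prop :=
  exists (alpha : C -> C -> C) (qf : 'I_L -> C -> C -> C),
    [/\ analytic_at00 alpha, alpha 0 0 != 0,
        \forall w \near ((0, 0) : C^o * C^o),
          q w.1 w.2 = alpha w.1 w.2 * \prod_(k < L) qf k w.1 w.2
      & forall k, [/\ weierstrass_polynomial (qf k) (N k),
                      irreducible_germ (qf k)
                    & puiseux_parametrization (qf k) (N k) (Psi k)]].

(* The N-th root of w with argument Arg w / N, where -pi < Arg w <= pi: it is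
   continuous off the negative real axis, whereas N.-root w is the root with
   argument arg w / N, where 0 <= arg w < 2 pi. *)
Definition principal_root (N : nat) (w : C) : C :=
  if 0 <= 'Im w then N.-root w else (N.-root (w^*))^*.

(* j < N indexes the N choices of the N-th root. *)
Definition branch (N : nat) (Psi : C -> C) (j : nat) (z2 : C) : C :=
  beta (Psi (expi (2 * pi * j%:R / N%:R) * principal_root N (beta_inv z2))).

(* psi lists the branches near (1, 1) of the zero set of a polynomial pt of
   bidegree at most (m, n). *)
Definition branches (m n : nat) (pt : {poly {poly C}}) (L0 : nat)
    (psi : 'I_L0 -> C -> C) : Prop :=
  exists (L : nat) (N : 'I_L -> nat) (Psi : 'I_L -> C -> C)
         (s : 'I_L0 -> {k : 'I_L & 'I_(N k)}),
    [/\ puiseux_factorization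
          (fun w1 w2 => (1 - 'i * w1) ^+ m * (1 - 'i * w2) ^+ n *
                        pt.[beta w1, beta w2]) N Psi,
        bijective s
      & forall l z2, psi l z2 =
          branch (N (tag (s l))) (Psi (tag (s l))) (tagged (s l)) z2].

Definition contact_order (psi : C -> C) (K : nat) : Prop :=
  ~~ odd K /\
  exists c : C, 0 < c /\
    \forall z \near (1 : C^o), `|z| = 1 ->
      1 - `|psi z| <= c * `|1 - z| ^+ K /\
      `|1 - z| ^+ K <= c * (1 - `|psi z|).

End Branches.

(* Main.v *)
(* In the coordinates w = beta^-1(z) the zeros of p~ near (1, 1) are the roots
   w1 of a product W of Weierstrass polynomials in w1, and those of p are the
   complex conjugates of the roots of W when w2 = t is real, because the
   transform P of p is obtained from the transform Q of p~ by conjugating the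
   coefficients.  For small t > 0 a root r of the k-th factor of W satisfies
   Im r >= c t^(kappa k), so two roots r, r' satisfy
     |conj r - r'| >= Im r + Im r' >= c t^(min (kappa k) (kappa k'))
   and the resultant of P and W, which is the product of the P(r, t) over the
   roots r, is at least a constant times t^D, D being the claimed bound.
   Algebraically, the local ideal contains all monomials of large degree, so W
   may be replaced by a Taylor truncation.  The local quotient is then a
   quotient of C[t]^L by the image of P(companion W), and its dimension is at
   most the order at 0 of the determinant of that matrix, that is, of the
   resultant, hence at most D. *)

Require Import Defs.
From HB Require Import structures.
From mathcomp Require Import all_boot all_order all_algebra.
From mathcomp Require Import perm complex ring lra.
From mathcomp Require Import all_classical all_reals all_analysis.

Set Implicit Arguments.
Unset Strict Implicit.
Unset Printing Implicit Defensive.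

Import Order.TTheory GRing.Theory Num.Theory.
Import numFieldNormedType.Exports.
Import Normc.

Local Open Scope classical_set_scope.
Local Open Scope ring_scope.

(** * Elimination *)

(** The multiplicity lives in the ring of rational functions regular at (1, 1), the branches in
    convergent power series. The two meet only at finite precision: having no common factor puts a
    nonzero polynomial in each single variable into the ideal, hence a power of each local
    coordinate, and beyond the resulting degree the germs may be cut off. The cut must also preserve
    the low coefficients of the determinant, and the precision takes both demands into account. The
    determinant is a polynomial in t, so its order is seen along t > 0 alone. There the principal
    N-th root is the real one, and the roots of a factor are the values of Psi at its products with
    the N-th roots of unity. Contact orders belong to branches, whereas the roots of a factor carry
    no label; kappa k makes sense because the branches of one factor have equal contact orders. Only
    an upper bound of the dimension is at stake, so spanning families suffice: the cokernel is
    treated by induction on the order of the determinant, in place of a Smith normal form, and a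
    basis is extracted at the end. *)

Section Gauss.
Variable F : closedFieldType.
Implicit Types (p q g : {poly {poly F}}) (a r : {poly F}).

(** Over a closed field the content of [g] in F[Y] is a unit exactly when no Y - c divides [g]. *)
Definition primitive_XY g := forall c : F, map_poly (horner_eval c) g != 0.

Lemma XsubC_dvdXY g (c : F) :
  map_poly (horner_eval c) g = 0 -> exists h, g = ('X - c%:P)%:P * h.
Proof.
move=> g0; exists (map_poly (fun a => a %/ ('X - c%:P)) g).
apply/polyP => i; rewrite coefCM coef_map_id0 ?div0p// mulrC divpK//.
rewrite dvdp_XsubCl; apply/rootP.
by have := congr1 (fun u : {poly F} => u`_i) g0; rewrite coef_map coef0.
Qed.

(** Each factor Y - c taken out lowers the degree of the leading coefficient, so the process
    stops. *)
Lemma primitive_partXY p :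
  p != 0 -> exists a g, [/\ a != 0, primitive_XY g & p = a%:P * g].
Proof.
have [k] := ubnP (size (lead_coef p)); elim: k p => // k IHk p.
rewrite ltnS => pk p0.
have [[c pc]|np] := pselect (exists c : F, map_poly (horner_eval c) p = 0); last first.
  by exists 1, p; rewrite oner_eq0 mul1r; split=> // c; apply/eqP => pc; apply: np;
    exists c.
have [h ph] := XsubC_dvdXY pc.
have h0 : h != 0 by apply: contraNneq p0 => h0; rewrite ph h0 mulr0.
have [||a [g [a0 gp hag]]] := IHk h => //.
  apply: leq_trans pk; rewrite ph lead_coefM lead_coefC size_mul.
  - by rewrite size_XsubC.
  - by rewrite polyXsubC_eq0.
  - by rewrite lead_coef_eq0.
exists (('X - c%:P) * a), g; rewrite mulf_neq0// ?polyXsubC_eq0//; split=> //.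
by rewrite ph hag polyCM mulrA.
Qed.

(** The roots of [a] are removed one at a time: at Y = c the left side vanishes and [g] does not, so
    Y - c divides [q] and cancels. *)
Lemma gaussXY g a p q :
  primitive_XY g -> a != 0 -> a%:P * p = g * q -> exists h, p = g * h.
Proof.
move=> gp; have [k] := ubnP (size a); elim: k a q => // k IHk a q.
rewrite ltnS => ak a0 apgq.
have [a1|a1] := boolP (size a == 1).
  exists ((a`_0)^-1%:P%:P * q); rewrite mulrCA -apgq mulrA.
  have [c c0 ->] := size_poly1P _ a1.
  by rewrite coefC/= -!polyCM mulVf// mul1r.
have [c ac] := closed_rootP _ a1.
have : map_poly (horner_eval c) q = 0.
  apply/eqP; have := congr1 (map_poly (horner_eval c)) apgq.
  rewrite !rmorphM/= map_polyC/= /horner_eval (rootP ac) mul0r => /esym/eqP.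
  by rewrite mulf_eq0 (negPf (gp c)).
move=> /XsubC_dvdXY[h qh].
have /factor_theorem[b ab] := ac.
have cX0 : ('X - c%:P)%:P != 0 :> {poly {poly F}} by rewrite polyC_eq0 polyXsubC_eq0.
have b0 : b != 0 by apply: contraNneq a0 => b0; rewrite ab b0 mul0r.
apply: (IHk b h) => //.
  apply: leq_trans ak; rewrite ab size_Mmonic ?monicXsubC// size_XsubC addn2.
  by rewrite ltnS.
by apply: (mulfI cX0); rewrite mulrA -polyCM [('X - _) * b]mulrC -ab apgq qh mulrCA.
Qed.

(* A gcd over the fraction field of F[Y], made primitive by removing the
   factors Y - c of its content, divides p and q over F[Y] by Gauss. *)
Lemma elimination p q : p != 0 -> no_common_factor p q ->
  exists r u v, r != 0 /\ r%:P = u * p + v * q.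
Proof.
move=> p0 pq.
have cst (f : {poly {poly F}}) : (size f <= 1)%N -> f = (f`_0)%:P by exact: size1_polyC.
have [p1|p1] := leqP (size p) 1.
  exists p`_0, 1, 0; rewrite mul0r addr0 mul1r -cst//; split=> //.
  by apply: contraNneq p0 => p00; rewrite (cst _ p1) p00.
have q0 : q != 0.
  apply: contraTneq p1 => q0.
  have := pq p 1 0; rewrite mulr1 mulr0 => /(_ erefl q0).
  by rewrite poly_unitE => /andP[/eqP->].
have [q1|q1] := leqP (size q) 1.
  exists q`_0, 0, 1; rewrite mul0r add0r mul1r -cst//; split=> //.
  by apply: contraNneq q0 => q00; rewrite (cst _ q1) q00.
have [[u v] /= _ ruv] := resultant_in_ideal p1 q1.
exists (resultant p q), u, v; split=> //.
rewrite resultant_eq0 -leqNgt leqNgt; apply/negP => g1.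
have g0 : gcdp p q != 0 by rewrite gcdp_eq0 negb_and p0.
have [a [g [a0 gp gE]]] := primitive_partXY g0.
have dvdg f : gcdp p q %| f -> exists h, f = g * h.
  move=> /Pdiv.Idomain.dvdpP[[c h]/= c0 E].
  apply: (@gaussXY g c f (a%:P * h)) => //.
  by rewrite mul_polyC E gE; ring.
have [f1 pE] := dvdg _ (dvdp_gcdl p q).
have [f2 qE] := dvdg _ (dvdp_gcdr p q).
have := pq _ _ _ pE qE; rewrite poly_unitE => /andP[/eqP g1' _].
move: g1; rewrite gE mul_polyC size_scale ?g1'//.
Qed.

End Gauss.

Lemma no_common_factor_swapXY (F : fieldType) (p q : {poly {poly F}}) :
  no_common_factor p q -> no_common_factor (swapXY p) (swapXY q).
Proof.
move=> pq d a b pda qdb.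
have /(rmorph_unit (swapXY : {rmorphism {poly {poly F}} -> {poly {poly F}}})) : swapXY d
  \is a GRing.unit; last by rewrite /= swapXYK.
apply: (pq _ (swapXY a) (swapXY b)).
  by rewrite -rmorphM/= -pda swapXYK.
by rewrite -rmorphM/= -qdb swapXYK.
Qed.

(** * Cokernels of matrices over F[T] *)

Section Cokernel.
Variable F : fieldType.
Variable L : nat.
Implicit Types (M : 'M[{poly F}]_L) (J : 'rV[{poly F}]_L -> Prop).

Definition submodule J :=
  [/\ J 0, forall u v, J u -> J v -> J (u + v) & forall g u, J u -> J (g *: u)].

Lemma submodule_mulmx J M u : submodule J -> (forall i, J (row i M)) -> J (u *m M).
Proof.
move=> [J0 JD JZ] JM; rewrite mulmx_sum_row.
by elim/big_ind : _ => // i _; exact/JZ.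
Qed.

(** Both [\det M] and 'X^k multiply every vector into [J], the former by the adjugate; they are
    coprime, and a Bezout relation concludes. *)
Lemma submodule_full J k M u : submodule J -> (forall u, J ('X^k *: u)) ->
  (forall i, J (row i M)) -> (\det M)`_0 != 0 -> J u.
Proof.
move=> Jsub Jk JM M0; have [_ JD JZ] := Jsub.
have : coprimep (\det M) 'X^k.
  by rewrite coprimep_expr// -['X]subr0 -polyC0 coprimep_XsubC /root horner_coef0.
move=> /Bezout_eq1_coprimepP[[a b] /= ab].
rewrite -[u]scale1r -ab scalerDl; apply: (JD).
  rewrite -scalerA; apply: (JZ).
  rewrite -mul_mx_scalar -mul_adj_mx mulmxA.
  exact: submodule_mulmx.
by rewrite -scalerA; exact/JZ.
Qed.

(* If T divides \det M, some constant combination of the rows of M is T *: m.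
   Replacing a row by m divides the determinant by T up to a unit, and enlarges J by the
   line spanned by m since T *: m is in J. *)
Lemma coker_spanned J (k d : nat) M :
  submodule J -> (forall u, J ('X^k *: u)) -> (forall i, J (row i M)) ->
  (\det M)`_d != 0 ->
  exists e : 'I_d -> 'rV[{poly F}]_L,
    forall u, exists c : 'I_d -> F, J (u - \sum_i (c i)%:P *: e i).
Proof.
elim: d J M => [|d IHd] J M Jsub Jk JM Md; have [J0 JD JZ] := Jsub;
  (have [M0|M0] := eqVneq ((\det M)`_0) 0; last first).
- exists (fun=> 0) => u; exists (fun=> 0); rewrite big1 ?subr0 => [|i _].
    exact: submodule_full Jk JM M0.
  by rewrite scaler0.
- by rewrite M0 eqxx in Md.
- exists (fun=> 0) => u; exists (fun=> 0); rewrite big1 ?subr0 => [|i _].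
    exact: submodule_full Jk JM M0.
  by rewrite scaler0.
have /eqP/det0P[v v0 vM] : \det (map_mx (horner_eval 0) M) = 0.
  by rewrite det_map_mx/= horner_evalE horner_coef0.
have [j vj] : exists j, v 0 j != 0.
  apply/existsP; apply: contra_neqT v0 => /existsPn v0.
  by apply/rowP => j; rewrite mxE; apply/eqP; rewrite -[_ == _]negbK v0.
pose w := map_mx polyC v.
have [m wM] : exists m, w *m M = 'X *: m.
  exists (map_mx (fun f => f %/ 'X) (w *m M)).
  apply/rowP => i; rewrite !mxE mulrC divpK// -['X]subr0 -polyC0 dvdp_XsubCl.
  apply/rootP; have /rowP/(_ i) := vM; rewrite !mxE => vMi.
  rewrite -[RHS]vMi horner_sum; apply: eq_bigr => l _.
  by rewrite !mxE hornerM hornerC.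
pose M' : 'M[{poly F}]_L := \matrix_i (if i == j then m else row i M).
have M'E i : row i M' = if i == j then m else row i M by rewrite rowK.
(* The cofactors along row [j] do not see that row, and multiplying [w *m M] by the adjugate of [M]
   gives [\det M *: w]. *)
have detM' : 'X * \det M' = (v 0 j)%:P * \det M.
  have cofM' l : cofactor M' j l = cofactor M j l.
    rewrite /cofactor; congr (_ * \det _); apply/matrixP => i i'.
    by rewrite !mxE eq_sym (negPf (neq_lift _ _)) mxE.
  transitivity ((w *m M *m \adj M) 0 j); last first.
    by rewrite -mulmxA mul_mx_adj mul_mx_scalar !mxE mulrC.
  rewrite (expand_det_row _ j) mulr_sumr mxE; apply: eq_bigr => l _.
  by rewrite cofM' wM !mxE eqxx mulrA.
pose J' u := exists a : F, J (u - a%:P *: m).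
have [|u|i||e eJ'] := IHd J' M'.
- split.
  + by exists 0; rewrite polyC0 scale0r subr0.
  + move=> u1 u2 [a1 J1] [a2 J2]; exists (a1 + a2).
    by rewrite polyCD scalerDl opprD addrACA; exact: JD.
  + move=> g u [a Ja]; exists (g.[0] * a).
    pose h := (g - g.[0]%:P) %/ 'X.
    have gE : g - g.[0]%:P = h * 'X.
      rewrite divpK// -['X]subr0 -polyC0 dvdp_XsubCl.
      by apply/rootP; rewrite hornerD hornerN hornerC subrr.
    have -> : g *: u - (g.[0] * a)%:P *: m = g *: (u - a%:P *: m) + (a%:P * h) *: (w *m M).
      have ah : a%:P * h * 'X = a%:P * (g - g.[0]%:P) by rewrite gE mulrA.
      rewrite wM scalerA ah mulrBr scalerBl scalerBr scalerA.
      by rewrite [g * _]mulrC subrKA polyCM mulrC.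
    by apply: JD; apply: JZ => //; exact: submodule_mulmx.
- by exists 0; rewrite polyC0 scale0r subr0.
- rewrite M'E; case: eqP => _; last by exists 0; rewrite polyC0 scale0r subr0.
  by exists 1; rewrite polyC1 scale1r subrr.
- have /(congr1 (fun f : {poly F} => f`_d.+1)) := detM'.
  by rewrite coefXM coefCM/= => ->; rewrite mulf_neq0.
exists (fun i => if unlift ord0 i is Some i' then e i' else m) => u.
have [c [a Ja]] := eJ' u.
exists (fun i => if unlift ord0 i is Some i' then c i' else a).
rewrite big_ord_recl unlift_none.
under eq_bigr do rewrite liftK.
by rewrite [X in u - X]addrC opprD addrA.
Qed.
End Cokernel.

(** * The local ring at a point *)

Section LocalRing.
Variable F : fieldType.
Variables (a b : F).
Notation "x %:F" := (@FracField.tofrac {poly {poly F}} x) : ring_scope.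
Notation K := {fraction {poly {poly F}}}.
Notation O := (@local_ring F a b).
Implicit Types (f g p q : {poly {poly F}}) (u v : K).

Lemma tofrac_neq0 g : g.[a, b] != 0 -> g%:F != 0.
Proof. by apply: contraNneq => /eqP; rewrite tofrac_eq0 => /eqP->; rewrite !horner0. Qed.

Lemma local_ring_tofrac f : O f%:F.
Proof. by exists f, 1; rewrite !hornerC oner_eq0 tofrac1 divr1. Qed.

Lemma local_ringD u v : O u -> O v -> O (u + v).
Proof.
move=> [f [g [g0 ->]]] [f' [g' [g0' ->]]].
exists (f * g' + f' * g), (g * g'); rewrite !hornerM mulf_neq0//; split=> //.
by rewrite addf_div ?tofrac_neq0// !(tofracD, tofracM).
Qed.

Lemma local_ringM u v : O u -> O v -> O (u * v).
Proof.
move=> [f [g [g0 ->]]] [f' [g' [g0' ->]]].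
exists (f * f'), (g * g'); rewrite !hornerM mulf_neq0//; split=> //.
by rewrite mulf_div !tofracM.
Qed.

Lemma local_ringV f : f.[a, b] != 0 -> O (f%:F)^-1.
Proof. by move=> f0; exists 1, f; rewrite tofrac1 div1r. Qed.

Lemma local_ringX u k : O u -> O (u ^+ k).
Proof.
move=> Ou; elim: k => [|k IHk]; last by rewrite exprS; exact: local_ringM.
by rewrite expr0 -tofrac1; exact: local_ring_tofrac.
Qed.

Lemma local_ring_sum (J : Type) (r : seq J) (P : pred J) (w : J -> K) :
  (forall j, P j -> O (w j)) -> O (\sum_(j <- r | P j) w j).
Proof.
move=> Ow; elim/big_ind : _ => //; last exact: local_ringD.
by rewrite -tofrac0; exact: local_ring_tofrac.
Qed.

Section Ideal.
Variables p q : {poly {poly F}}.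
Notation I := (@local_ideal F p q a b).

Lemma local_idealD u v : I u -> I v -> I (u + v).
Proof.
move=> [u1 [u2 [Ou1 [Ou2 ->]]]] [v1 [v2 [Ov1 [Ov2 ->]]]].
exists (u1 + v1), (u2 + v2); do ![split; first exact: local_ringD].
by rewrite !mulrDl addrACA.
Qed.

Lemma local_idealM u v : O u -> I v -> I (u * v).
Proof.
move=> Ou [v1 [v2 [Ov1 [Ov2 ->]]]].
exists (u * v1), (u * v2); do ![split; first exact: local_ringM].
by rewrite mulrDr !mulrA.
Qed.

Lemma local_ideal_gen u v : O u -> O v -> I (u * p%:F + v * q%:F).
Proof. by move=> Ou Ov; exists u, v. Qed.

Lemma local_ideal0 : I 0.
Proof. by exists 0, 0; rewrite -tofrac0 !mul0r addr0; do !split;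
  exact: local_ring_tofrac. Qed.

Lemma local_idealB u v : I u -> I v -> I (u - v).
Proof.
move=> Iu Iv; apply: local_idealD => //; rewrite -mulN1r -tofrac1 -tofracN.
by apply: local_idealM => //; exact: local_ring_tofrac.
Qed.

Lemma local_ideal_sum (J : Type) (r : seq J) (P : pred J) (w : J -> K) :
  (forall j, P j -> I (w j)) -> I (\sum_(j <- r | P j) w j).
Proof.
by move=> Iw; elim/big_ind : _ => //; [exact: local_ideal0|exact: local_idealD].
Qed.

Lemma local_idealX u k l : (k <= l)%N -> O u -> I (u ^+ k) -> I (u ^+ l).
Proof.
move=> kl Ou Iu; rewrite -(subnK kl) exprD.
by apply: local_idealM => //; exact: local_ringX.
Qed.

Lemma local_idealXD u v k l :
  O u -> O v -> I (u ^+ k) -> I (v ^+ l) -> I ((u + v) ^+ (k + l)).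
Proof.
move=> Ou Ov Iu Iv; rewrite exprDn; apply: local_ideal_sum => i _.
rewrite -mulr_natl; apply: local_idealM.
  by rewrite -(rmorph_nat (@FracField.tofrac {poly {poly F}})); exact: local_ring_tofrac.
have [li|il] := leqP l i.
  by apply: local_idealM; [exact: local_ringX|exact: local_idealX Iv].
rewrite mulrC; apply: local_idealM; first exact: local_ringX.
by apply: local_idealX Iu => //;
  rewrite leq_subRL ?leq_add2l 1?addnC ?leq_add2l ?(ltnW il)//; case: i il => /= i;
    rewrite ltnS.
Qed.

(** The multiplicity requires a basis of the quotient; a spanning family shrinks to one by dropping
    elements that occur in a linear relation. This also shows that the multiplicity exists. *)
Lemma intersection_multiplicity_le (D : nat) (e : 'I_D -> K) :
  (forall i, O (e i)) ->
  (forall u, O u -> exists c : 'I_D -> F, I (u - \sum_(i < D) (c i)%:P%:P%:F * e i)) ->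
  exists N, intersection_multiplicity p q a b N /\ (N <= D)%N.
Proof.
elim: D e => [|D IHD] e Oe espan.
  by exists 0; split=> //; exists e; split=> // c _ [].
have [efree|] := pselect (forall c : 'I_D.+1 -> F,
    I (\sum_(i < D.+1) (c i)%:P%:P%:F * e i) -> forall i, c i = 0).
  by exists D.+1; split=> //; exists e.
move=> /existsNP[c /not_implyP[Ic /existsNP[j /eqP cj]]].
have [||N [HN ND]] := IHD (e \o lift j); last by exists N; split=> //; exact: leqW.
  by move=> i; exact: Oe.
move=> u Ou; have [c' Ic'] := espan u Ou.
exists (fun i => c' (lift j i) - c' j / c j * c (lift j i)).
have := local_idealM (local_ring_tofrac (c' j / c j)%:P%:P) Ic.
move=> /(local_idealD Ic'); congr (I _).
rewrite -addrA; congr (_ + _).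
rewrite mulr_sumr -sumrN -big_split/= (bigD1_ord j)//=.
rewrite mulrA -tofracM -!polyCM divfK// addNr add0r -sumrN.
apply: eq_bigr => i _; rewrite mulrA -tofracM -!polyCM -mulNr -mulrDl -mulNr.
by rewrite -tofracN -tofracD -!polyCN -!polyCD -tofracN -!polyCN opprB addrC.
Qed.

End Ideal.
End LocalRing.

(** * The change of coordinates beta, on polynomials and in the local ring *)

Section Mobius.
Variables (F : fieldType) (im : F).
Implicit Types f : {poly {poly F}}.

(* The polynomial (1 - im X)^m (1 - im Y)^n f((1 + im X) / (1 - im X),
   (1 + im Y) / (1 - im Y)), when f has bidegree at most (m, n). *)
Definition mobius (m n : nat) f : {poly {poly F}} :=
  \sum_(i < m.+1) \sum_(j < n.+1)
     (f`_i`_j)%:P%:P * ((1 + im%:P%:P * 'X) ^+ i * (1 - im%:P%:P * 'X) ^+ (m - i)) *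
     ((1 + im%:P%:P * 'X%:P) ^+ j * (1 - im%:P%:P * 'X%:P) ^+ (n - j)).

Lemma poly_wide (S : nzSemiRingType) k (g : {poly S}) : (size g <= k)%N ->
  g = \sum_(i < k) (g`_i)%:P * 'X ^+ i.
Proof.
move=> gk; transitivity (\poly_(i < k) g`_i).
  apply/polyP => i; rewrite coef_poly; case: ltnP => // ki.
  by rewrite nth_default// (leq_trans gk).
by rewrite poly_def; apply: eq_bigr => i _; rewrite mul_polyC.
Qed.

Lemma polyXY_wide m n f : (size f <= m)%N -> (sizeY f <= n)%N ->
  f = \sum_(i < m) \sum_(j < n) (f`_i`_j)%:P%:P * 'X%:P ^+ j * 'X ^+ i.
Proof.
move=> fm fn; rewrite [LHS](poly_wide fm); apply: eq_bigr => i _.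
rewrite [in LHS](@poly_wide _ n f`_i) ?(leq_trans (max_size_coefXY _ _))//.
by rewrite rmorph_sum mulr_suml; apply: eq_bigr => j _; rewrite rmorphM rmorphXn.
Qed.

(** To be read with [h] as evaluation at a point and [g] as evaluation at its image under beta; the
    hypotheses are beta with denominators cleared. *)
Lemma mobius_morph (S : comNzRingType) (g h : {rmorphism {poly {poly F}} -> S}) m n f :
  (forall c : F, g c%:P%:P = h c%:P%:P) ->
  g 'X * h (1 - im%:P%:P * 'X) = h (1 + im%:P%:P * 'X) ->
  g 'X%:P * h (1 - im%:P%:P * 'X%:P) = h (1 + im%:P%:P * 'X%:P) ->
  (size f <= m.+1)%N -> (sizeY f <= n.+1)%N ->
  h (mobius m n f) =
    h (1 - im%:P%:P * 'X) ^+ m * h (1 - im%:P%:P * 'X%:P) ^+ n * g f.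
Proof.
move=> ghC ghX ghY fm fn; rewrite [in RHS](polyXY_wide fm fn) !rmorph_sum mulr_sumr.
apply: eq_bigr => i _; rewrite !rmorph_sum mulr_sumr; apply: eq_bigr => j _.
rewrite !(rmorphM, rmorphXn) ghC -ghX -ghY !exprMn.
have expB (k : nat) (l : 'I_k.+1) (u : S) : u ^+ k = u ^+ l * u ^+ (k - l).
  by rewrite -exprD subnKC// -ltnS.
by rewrite (expB _ i) (expB _ j); ring.
Qed.

Lemma hornerXY_coef m n f a b : (size f <= m)%N -> (sizeY f <= n)%N ->
  f.[a, b] = \sum_(i < m) \sum_(j < n) f`_i`_j * b ^+ j * a ^+ i.
Proof.
move=> fm fn; rewrite [in LHS](polyXY_wide fm fn) !horner_sum; apply: eq_bigr => i _.
rewrite !horner_sum; apply: eq_bigr => j _.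
by rewrite !(hornerM, horner_exp, hornerX, hornerC).
Qed.

Lemma horner_mobius m n f u v :
  (mobius m n f).[u, v] = \sum_(i < m.+1) \sum_(j < n.+1)
    f`_i`_j * ((1 + im * u) ^+ i * (1 - im * u) ^+ (m - i)) *
              ((1 + im * v) ^+ j * (1 - im * v) ^+ (n - j)).
Proof.
rewrite !horner_sum; apply: eq_bigr => i _.
rewrite !horner_sum; apply: eq_bigr => j _.
by rewrite !(hornerM, horner_exp, hornerD, hornerN, hornerX, hornerC).
Qed.

Lemma horner_mobius_div m n f u v : (size f <= m.+1)%N -> (sizeY f <= n.+1)%N ->
  1 - im * u != 0 -> 1 - im * v != 0 ->
  (mobius m n f).[u, v] = (1 - im * u) ^+ m * (1 - im * v) ^+ n *
    f.[(1 + im * u) / (1 - im * u), (1 + im * v) / (1 - im * v)].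
Proof.
move=> fm fn u0 v0; rewrite horner_mobius (hornerXY_coef _ _ fm fn) mulr_sumr.
apply: eq_bigr => i _; rewrite mulr_sumr; apply: eq_bigr => j _.
have expB (k : nat) (l : 'I_k.+1) (z : F) : z ^+ k = z ^+ l * z ^+ (k - l).
  by rewrite -exprD subnKC// -ltnS.
by rewrite (expB _ i) (expB _ j) !expr_div_n; field; rewrite !expf_neq0.
Qed.

End Mobius.

Section EvalXY.
Variables (F : comNzRingType) (S : comNzRingType) (io : {rmorphism F -> S}) (x y : S).

Definition evalY : {rmorphism {poly F} -> S} := horner_morph (fun a : F => mulrC y (io a)).
Definition evalXY : {rmorphism {poly {poly F}} -> S} :=
  horner_morph (fun a : {poly F} => mulrC x (evalY a)).

Lemma evalYC c : evalY c%:P = io c. Proof. exact: horner_morphC. Qed.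
Lemma evalYX : evalY 'X = y. Proof. exact: horner_morphX. Qed.
Lemma evalXYC g : evalXY g%:P = evalY g. Proof. exact: horner_morphC. Qed.
Lemma evalXYX : evalXY 'X = x. Proof. exact: horner_morphX. Qed.
Definition evalXYE := (evalXYX, evalXYC, evalYX, evalYC).
End EvalXY.

Section LocalCoordinates.
Variable F : numClosedFieldType.
Notation "x %:F" := (@FracField.tofrac {poly {poly F}} x) : ring_scope.
Notation K := {fraction {poly {poly F}}}.
Notation O := (@local_ring F 1 1).
Implicit Types (f g p q Z : {poly {poly F}}) (u v : K).

Definition fracC : {rmorphism F -> K} := @FracField.tofrac {poly {poly F}} \o (polyC \o
  polyC).

(** This is beta^-1 in the function field: [x] and [y] below are w1 and w2 seen as elements of the
    local ring at (1, 1). *)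
Definition cayley (Z : {poly {poly F}}) : K := fracC 'i * (1 - Z)%:F / (1 + Z)%:F.

Notation x := (cayley 'X).
Notation y := (cayley 'X%:P).
Notation ev := (evalXY fracC x y).

Lemma add1_11 (Z : {poly {poly F}}) : Z.[1, 1] = 1 -> (1 + Z).[1, 1] != 0.
Proof. by move=> Z1; rewrite !hornerD Z1 !hornerE (pnatr_eq0 F 2). Qed.

Lemma cayley_local (Z : {poly {poly F}}) : Z.[1, 1] = 1 -> O (cayley Z).
Proof.
move=> Z1; apply: local_ringM.
  by apply: local_ringM; exact: local_ring_tofrac.
exact/local_ringV/add1_11.
Qed.

Lemma subr1_cayley (Z : {poly {poly F}}) : Z.[1, 1] = 1 ->
  1 - fracC 'i * cayley Z = fracC 2 / (1 + Z)%:F.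
Proof.
move=> Z1; have Z0 : (1 + Z)%:F != 0.
  by apply: (@tofrac_neq0 F 1 1); exact: add1_11.
rewrite /cayley mulrA mulrA -rmorphM -expr2 sqrCi rmorphN1 mulN1r mulNr opprK.
apply: (mulIf Z0); rewrite divfK// mulrDl divfK// mul1r -tofracD.
by rewrite rmorph_nat -tofracMn; congr tofrac; ring.
Qed.

Lemma addr1_cayley (Z : {poly {poly F}}) : Z.[1, 1] = 1 ->
  1 + fracC 'i * cayley Z = Z%:F * (fracC 2 / (1 + Z)%:F).
Proof.
move=> Z1; have Z0 : (1 + Z)%:F != 0.
  by apply: (@tofrac_neq0 F 1 1); exact: add1_11.
rewrite /cayley mulrA mulrA -rmorphM -expr2 sqrCi rmorphN1 mulN1r mulNr.
apply: (mulIf Z0); rewrite mulrA divfK// mulrBl divfK// mul1r -tofracB.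
by rewrite rmorph_nat mulr_natr -tofracMn; congr tofrac; ring.
Qed.

Lemma hornerX_11 : ('X : {poly {poly F}}).[1, 1] = 1.
Proof. by rewrite hornerX hornerC. Qed.

Lemma hornerY_11 : ('X%:P : {poly {poly F}}).[1, 1] = 1.
Proof. by rewrite hornerC hornerX. Qed.

Let Ox : O x. Proof. exact/cayley_local/hornerX_11. Qed.
Let Oy : O y. Proof. exact/cayley_local/hornerY_11. Qed.

Lemma evalXY_local f : O (ev f).
Proof.
rewrite (@polyXY_wide F _ _ f (leqnn _) (leqnn _)) rmorph_sum.
apply: local_ring_sum => i _; rewrite rmorph_sum; apply: local_ring_sum => j _.
rewrite !(rmorphM, rmorphXn)/= !evalXYE.
apply: local_ringM; last exact: local_ringX.
by apply: local_ringM; [exact: local_ring_tofrac|exact: local_ringX].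
Qed.

(** The factors 2 / (1 + z) are units at (1, 1), so [f] and its transform agree there up to a
    unit. *)
Lemma evalXY_mobius m n f : (size f <= m.+1)%N -> (sizeY f <= n.+1)%N ->
  ev (mobius 'i m n f) =
    (fracC 2 / (1 + 'X)%:F) ^+ m * (fracC 2 / (1 + 'X%:P)%:F) ^+ n * f%:F.
Proof.
move=> fm fn; rewrite (@mobius_morph F 'i K (@FracField.tofrac {poly {poly F}}) ev)//.
- by rewrite !(rmorphB, rmorphM, rmorph1)/= !evalXYE !subr1_cayley ?hornerX_11 ?hornerY_11.
- by move=> c; rewrite !evalXYE.
- rewrite !(rmorphB, rmorphD, rmorphM, rmorph1)/= !evalXYE.
  by rewrite subr1_cayley ?addr1_cayley ?hornerX_11.
- rewrite !(rmorphB, rmorphD, rmorphM, rmorph1)/= !evalXYE.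
  by rewrite subr1_cayley ?addr1_cayley ?hornerY_11.
Qed.

Lemma mobius00 m n f : (size f <= m.+1)%N -> (sizeY f <= n.+1)%N ->
  (mobius 'i m n f).[0, 0] = f.[1, 1].
Proof.
move=> fm fn.
by rewrite horner_mobius_div ?mulr0 ?subr0 ?addr0 ?oner_eq0 ?divr1 ?expr1n ?mul1r.
Qed.

(** Numerator and denominator are transformed with the same bidegree bounds, so the prefactors
    cancel in the quotient. *)
Lemma evalXY_surj u : O u -> exists f g, [/\ g.[0, 0] != 0, ev g != 0 & u = ev f / ev g].
Proof.
move=> [f [g [g0 ->]]].
pose m := maxn (size f) (size g); pose n := maxn (sizeY f) (sizeY g).
have [fm gm fn gn] : [/\ (size f <= m.+1)%N, (size g <= m.+1)%N,
    (sizeY f <= n.+1)%N & (sizeY g <= n.+1)%N].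
  by split; apply: leqW; rewrite ?leq_maxl ?leq_maxr.
have Z0 (Z : {poly {poly F}}) : Z.[1, 1] = 1 -> fracC 2 / (1 + Z)%:F != 0.
  move=> Z1; rewrite mulf_neq0 ?invr_eq0//.
    by apply: (@tofrac_neq0 F 1 1 2%:P%:P); rewrite !hornerC pnatr_eq0.
  by apply: (@tofrac_neq0 F 1 1); exact: add1_11.
exists (mobius 'i m n f), (mobius 'i m n g); rewrite mobius00//.
rewrite !evalXY_mobius//.
have U0 : (fracC 2 / (1 + 'X)%:F) ^+ m * (fracC 2 / (1 + 'X%:P)%:F) ^+ n != 0.
  by rewrite mulf_neq0// expf_neq0// Z0// ?hornerX_11 ?hornerY_11.
move: (_ ^+ m * _) U0 => U U0.
have fg0 := tofrac_neq0 g0.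
split; [exact: g0|exact: mulf_neq0 U0 fg0|].
by rewrite -(mulf_div U U f%:F g%:F) (divff U0) mul1r.
Qed.

End LocalCoordinates.

(** * Companion matrices, with a size given apart from the polynomial so that matrices for varying
    polynomials have one type *)

Definition companion (S : nzRingType) L (W : {poly S}) : 'M[S]_L :=
  \matrix_(i, j) if i == L.-1 :> nat then - W`_j else (i.+1 == j :> nat)%:R.

Lemma char_poly_companion (S : comNzRingType) L (W : {poly S}) :
  W \is monic -> size W = L.+1 -> char_poly (companion L W) = W.
Proof.
move=> Wm WL; have LE : L = (size W).-1 by rewrite WL.
by subst L; exact: companionmxK.
Qed.

(** Row i holds the coefficients of X^(i+1) modulo [W], so the matrix acts on coefficient vectors as
    multiplication by X modulo [W]. *)
Lemma rVpoly_companion (S : comNzRingType) L (W : {poly S}) (v : 'rV[S]_L.+1) :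
  W \is monic -> size W = L.+2 ->
  rVpoly (v *m companion L.+1 W) = 'X * rVpoly v - (v 0 ord_max)%:P * W.
Proof.
move=> Wm WL; apply/polyP => k; rewrite coefB coefXM coefCM.
have [kL|Lk] := ltnP k L.+1; last first.
  rewrite nth_default ?(leq_trans (size_poly _ _))//.
  move: Lk; rewrite leq_eqVlt => /predU1P[<-|Lk].
    have -> : W`_L.+1 = 1 by rewrite -(monicP Wm) lead_coefE WL.
    rewrite mulr1 /=.
    by rewrite -[L]/(nat_of_ord (@ord_max L)) coef_rVpoly_ord subrr.
  rewrite gtn_eqF ?(leq_trans _ Lk)// nth_default ?(leq_trans (size_poly _ _))//.
    by rewrite nth_default ?mulr0 ?subr0// WL.
  by rewrite -ltnS prednK// (leq_trans _ Lk).
rewrite -[k in LHS]/(nat_of_ord (Ordinal kL)) coef_rVpoly_ord mxE big_ord_recr/=.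
rewrite [companion _ _ _ _]mxE eqxx mulrN; congr (_ - _).
case: k kL => [|k] kL /=.
  rewrite big1// => i _; rewrite mxE /= ltn_eqF ?ltn_ord//.
  by rewrite mulr0.
pose j := Ordinal (ltnW kL : (k < L.+1)%N).
rewrite -[k in RHS]/(nat_of_ord j) coef_rVpoly_ord.
have kL' : (k < L)%N by [].
rewrite (bigD1 (Ordinal kL'))//= mxE/= ltn_eqF// eqxx mulr1 big1 ?addr0.
  by congr (v _ _); apply/val_inj.
move=> i ik; rewrite mxE/= ltn_eqF ?ltn_ord// eqSS (_ : (i == k :> nat) = false) ?mulr0//.
by apply/negbTE.
Qed.

Lemma rVpoly_horner_companion (S : comNzRingType) L (W P : {poly S}) (v : 'rV[S]_L.+1) :
  W \is monic -> size W = L.+2 ->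
  exists h, rVpoly (v *m horner_mx (companion L.+1 W) P) = P * rVpoly v + h * W.
Proof.
move=> Wm WL; elim/poly_ind: P => [|P c [h IHP]].
  by exists 0; rewrite rmorph0 mulmx0 !mul0r addr0 linear0.
exists ('X * h - (((v *m horner_mx (companion L.+1 W) P) 0 ord_max)%:P)).
rewrite rmorphD rmorphM/= horner_mx_X horner_mx_C mulmxDr mulmxA linearD/=.
rewrite rVpoly_companion// IHP mul_mx_scalar linearZ/= -mul_polyC.
by ring.
Qed.

(** * The multiplicity is at most the order of a determinant *)

Section LocalBound.
Variable F : numClosedFieldType.
Notation "x %:F" := (@FracField.tofrac {poly {poly F}} x) : ring_scope.
Notation K := {fraction {poly {poly F}}}.
Notation O := (@local_ring F 1 1).
Notation x := (@cayley F 'X).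
Notation y := (@cayley F 'X%:P).
Notation ev := (evalXY (@fracC F) x y).
Variables p q : {poly {poly F}}.
Hypotheses (p0 : p != 0) (pq : no_common_factor p q).
Notation I := (@local_ideal F p q 1 1).

Let Ox : O x. Proof. exact/cayley_local/hornerX_11. Qed.
Let Oy : O y. Proof. exact/cayley_local/hornerY_11. Qed.

Lemma cayley_nilpotent (Z r : {poly {poly F}}) k :
  Z.[1, 1] = 1 -> r.[1, 1] != 0 -> I (r * (Z - 1) ^+ k)%:F -> I (cayley Z ^+ k).
Proof.
move=> Z1 r1 Irz.
have -> : cayley Z ^+ k =
    (r%:F)^-1 * (fracC F (- 'i) / (1 + Z)%:F) ^+ k * (r * (Z - 1) ^+ k)%:F.
  rewrite tofracM mulrACA mulrA mulVf ?(tofrac_neq0 r1)// mul1r.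
  rewrite tofracXn -exprMn; congr (_ ^+ k).
  by rewrite /cayley rmorphN mulrAC !tofracB; ring.
apply: local_idealM => //; apply: local_ringM; first exact: local_ringV.
apply: local_ringX; apply: local_ringM; first exact: local_ring_tofrac.
exact/local_ringV/add1_11.
Qed.

(** Elimination yields a nonzero polynomial in z2 alone in the ideal; at z2 = 1 it is a unit times a
    power of z2 - 1, and so a unit times a power of [y]. Swapping the variables treats [x]. *)
Lemma xy_nilpotent : exists k, I (x ^+ k) /\ I (y ^+ k).
Proof.
have [r [u [v [r0 ruv]]]] := elimination p0 pq.
have Ir : I (r%:P)%:F.
  by rewrite ruv tofracD !tofracM; apply: local_ideal_gen; exact: local_ring_tofrac.
have Iy : exists k, I (y ^+ k).
  have [k [r' + rE]] := multiplicity_XsubC r 1; rewrite r0/= => r'1.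
  exists k; apply: (@cayley_nilpotent _ r'%:P); [exact: hornerY_11|by rewrite hornerC|].
  by move: Ir; rewrite rE polyCM polyC_exp polyCB.
have p0' : swapXY p != 0 by rewrite swapXY_eq0.
have [s [u' [v' [s0 suv]]]] := elimination p0' (no_common_factor_swapXY pq).
have Is : I (s^:P)%:F.
  rewrite -swapXY_polyC suv rmorphD !rmorphM/= !swapXYK tofracD !tofracM.
  by apply: local_ideal_gen; exact: local_ring_tofrac.
have [l [s' + sE]] := multiplicity_XsubC s 1; rewrite s0/= => s'1.
have [k Iyk] := Iy; exists (l + k)%N; split; last first.
  by apply: (local_idealX (k := k)) => //; exact: leq_addl.
apply: (local_idealX (k := l)) => //; first exact: leq_addr.
apply: (@cayley_nilpotent _ s'^:P); [exact: hornerX_11| |].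
  by rewrite horner_map hornerC.
by move: Is; rewrite sE rmorphM rmorphXn/= rmorphB/= map_polyX map_polyC.
Qed.

Section Coordinates.
Variables (k : nat).
Hypotheses (Ixk : I (x ^+ k)) (Iyk : I (y ^+ k)).

(** A monomial of total degree at least 2k has an exponent at least k. *)
Lemma evalXY_high_order (E : {poly {poly F}}) :
  (forall i j, (i + j < k + k)%N -> E`_i`_j = 0) -> I (ev E).
Proof.
move=> E0; rewrite (@polyXY_wide F _ _ E (leqnn _) (leqnn _)) rmorph_sum.
apply: local_ideal_sum => i _; rewrite rmorph_sum; apply: local_ideal_sum => j _.
have [ij|kij] := ltnP (i + j) (k + k).
  by rewrite E0// !mul0r rmorph0; exact: local_ideal0.
rewrite !(rmorphM, rmorphXn)/= !evalXYE.
have Oc : O (fracC F E`_i`_j) by exact: local_ring_tofrac.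
have [ki|ik] := leqP k i.
  apply: local_idealM; last exact: local_idealX Ixk.
  by apply: local_ringM => //; exact: local_ringX.
rewrite mulrC; apply: local_idealM; first exact: local_ringX.
apply: local_idealM => //; apply: local_idealX Iyk => //.
by rewrite leqNgt; apply/negP => jk; move: kij; rewrite leqNgt -addnS leq_add ?(ltnW ik)//.
Qed.

Lemma evalXY_nilpotent (H : {poly {poly F}}) : H.[0, 0] = 0 -> I (ev H ^+ (k + k)).
Proof.
move=> H0.
have /factor_theorem[A HA] : root (H - H.[0]%:P) 0.
  by apply/rootP; rewrite hornerD hornerN hornerC subrr.
have /factor_theorem[B HB] : root H.[0] 0 by apply/rootP; rewrite -[RHS]H0 polyC0.
have -> : ev H = ev A * x + ev B%:P * y.
  rewrite -[H](subrK H.[0]%:P) HA HB !polyC0 !subr0 polyCM rmorphD !rmorphM/=.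
  by rewrite !evalXYE.
have OA f : O (ev f) by exact: evalXY_local.
apply: local_idealXD.
- exact: local_ringM.
- exact: local_ringM.
- rewrite [(_ * x) ^+ k]exprMn; apply: local_idealM => //.
  exact/local_ringX/OA.
- rewrite [(_ * y) ^+ k]exprMn; apply: local_idealM => //.
  exact/local_ringX/OA.
Qed.

(** Polynomials without constant term are nilpotent modulo the ideal, so a finite geometric series
    inverts [g], and the inverse is again a polynomial in [x] and [y]. *)
Lemma evalXY_inverse (g : {poly {poly F}}) : g.[0, 0] != 0 -> exists s, I (1 - ev s * ev g).
Proof.
move=> g0; pose c := (g.[0, 0])^-1; pose h := 1 - c%:P%:P * g.
exists (c%:P%:P * \sum_(i < k + k) h ^+ i).
have h0 : h.[0, 0] = 0.
  by rewrite /h !hornerE mulVf// subrr.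
rewrite -rmorphM -(rmorph1 ev) -rmorphB/=.
rewrite (_ : 1 - _ = h ^+ (k + k)) ?rmorphXn/=; first exact: evalXY_nilpotent.
rewrite -[RHS](subrK 1) subrX1 (_ : h - 1 = - (c%:P%:P * g)); first by ring.
by rewrite /h; ring.
Qed.

(** Once the denominator of [u] is replaced by a polynomial inverse, division by the monic [W]
    leaves a remainder of degree less than [L] in the first variable. *)
Lemma evalXY_span L W u : W \is monic -> size W = L.+1 -> I (ev W) -> O u ->
  exists v : 'rV[{poly F}]_L, I (u - ev (rVpoly v)).
Proof.
move=> Wm WL IW Ou; have [f [g [g0 eg0 uE]]] := evalXY_surj Ou.
have [s Is] := evalXY_inverse g0.
have [d [r [rE rL]]] : exists d r, f * s = d * W + r /\ (size r <= L)%N.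
  exists (Pdiv.Ring.rdivp (f * s) W), (Pdiv.Ring.rmodp (f * s) W); split.
    exact: Pdiv.RingMonic.rdivp_eq.
  by rewrite -ltnS -WL Pdiv.Ring.ltn_rmodp monic_neq0.
exists (poly_rV r); rewrite poly_rV_K//.
have -> : u - ev r = u * (1 - ev s * ev g) + ev d * ev W.
  have -> : ev r = ev f * ev s - ev d * ev W.
    by rewrite -!rmorphM rE rmorphD addrAC subrr add0r.
  move: (ev f) (ev g) (ev s) (ev d * _) eg0 uE => f' g' s' w eg0 ->.
  by rewrite opprB mulrBr mulr1 [s' * _]mulrC mulrA divfK// addrA addrAC.
apply: local_idealD; apply: local_idealM => //; exact: evalXY_local.
Qed.

End Coordinates.

(* [al * W] is a truncation of the factorization of the transform of q into a
   unit and a Weierstrass polynomial; the discarded monomials are in the local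
   ideal.  The rows of the matrix represent the multiples of the transform of p
   modulo W. *)
Lemma local_multiplicity_bound (m n : nat) :
  (size p <= m.+1)%N -> (sizeY p <= n.+1)%N ->
  (size q <= m.+1)%N -> (sizeY q <= n.+1)%N ->
  exists k0, forall L al W d,
    W \is monic -> size W = L.+2 -> al.[0, 0] != 0 ->
    (forall i j, (i + j < k0)%N -> (mobius 'i m n q - al * W)`_i`_j = 0) ->
    (\det (horner_mx (companion L.+1 W) (mobius 'i m n p)))`_d != 0 ->
    exists N, intersection_multiplicity p q 1 1 N /\ (N <= d)%N.
Proof.
move=> pm pn qm qn; have [k [Ixk Iyk]] := xy_nilpotent.
(* The precision depends on [p] and [q] only, so the truncation can be chosen after it. *)
exists (k + k)%N => L al W d Wm WL al0 QE detd.
set P := mobius 'i m n p in detd; set Q := mobius 'i m n q in QE.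
have IP : I (ev P).
  rewrite evalXY_mobius//; apply: local_idealM.
    apply: local_ringM; apply: local_ringX; apply: local_ringM;
      by [exact: local_ring_tofrac | exact/local_ringV/add1_11/hornerX_11
        | exact/local_ringV/add1_11/hornerY_11].
  rewrite -[p%:F]mul1r -[_ * _]addr0 -[X in _ + X](mul0r q%:F) -tofrac0 -tofrac1.
  by apply: local_ideal_gen; exact: local_ring_tofrac.
have IQ : I (ev Q).
  rewrite evalXY_mobius//; apply: local_idealM.
    apply: local_ringM; apply: local_ringX; apply: local_ringM;
      by [exact: local_ring_tofrac | exact/local_ringV/add1_11/hornerX_11
        | exact/local_ringV/add1_11/hornerY_11].
  rewrite -[q%:F]mul1r -[_ * _]add0r -[X in X + _](mul0r p%:F) -tofrac0 -tofrac1.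
  by apply: local_ideal_gen; exact: local_ring_tofrac.
have IalW : I (ev al * ev W).
  rewrite -rmorphM/= -[al * W](subKr Q) rmorphB.
  by apply: local_idealB => //; exact: evalXY_high_order QE.
have IW : I (ev W).
  have [s Is] := evalXY_inverse Ixk Iyk al0.
  have -> : ev W = ev W * (1 - ev s * ev al) + ev s * (ev al * ev W) by ring.
  by apply: local_idealD; apply: local_idealM => //; exact: evalXY_local.
pose J (v : 'rV[{poly F}]_L.+1) := I (ev (rVpoly v)).
have evZ g (v : 'rV[{poly F}]_L.+1) : ev (rVpoly (g *: v)) = evalY (@fracC F) y g * ev
  (rVpoly v).
  by rewrite linearZ/= -mul_polyC rmorphM/= evalXYE.
have Jsub : submodule J.
  split.
  - by rewrite /J linear0 rmorph0; exact: local_ideal0.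
  - by move=> u v Ju Jv; rewrite /J linearD rmorphD; exact: local_idealD.
  - move=> g u Ju; rewrite /J evZ; apply: local_idealM => //.
    by rewrite -(evalXYC _ x); exact: evalXY_local.
have Jk u : J ('X^k *: u).
  rewrite /J evZ rmorphXn/= evalYX mulrC; apply: local_idealM => //.
  exact: evalXY_local.
have [|e eJ] := coker_spanned Jsub Jk _ detd.
  move=> i; rewrite rowE /J.
  have [h ->] := rVpoly_horner_companion P (delta_mx 0 i) Wm WL.
  rewrite rmorphD !rmorphM mulrC; apply: local_idealD; apply: local_idealM => //;
    exact: evalXY_local.
apply: (@intersection_multiplicity_le F 1 1 p q d (fun i => ev (rVpoly (e i)))).
  by move=> i; exact: evalXY_local.
move=> u Ou; have [v Iv] := evalXY_span Ixk Iyk Wm WL IW Ou.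
have [c Jc] := eJ v; exists c.
have := local_idealD Iv Jc; congr (I _).
rewrite linearB rmorphB/= addrA subrK; congr (_ - _).
rewrite linear_sum rmorph_sum; apply: eq_bigr => i _.
by rewrite evZ evalYC.
Qed.

End LocalBound.

(** [P] splits into factors X - b, and up to sign \det (A - b) is the characteristic polynomial at
    b, that is, the product of the b - r. *)
Lemma det_horner_mx (F : closedFieldType) n (A : 'M[F]_n.+1) (P : {poly F}) (rs : seq F) :
  char_poly A = \prod_(r <- rs) ('X - r%:P) ->
  \det (horner_mx A P) = \prod_(r <- rs) P.[r].
Proof.
move=> Ars.
have rsn : size rs = n.+1.
  by have := size_char_poly A; rewrite Ars size_prod_XsubC => -[].
have [->|P0] := eqVneq P 0.
  rewrite rmorph0 det0; case: rs rsn {Ars} => // r rs _.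
  by rewrite big_cons horner0 mul0r.
have [bs PE] := closed_field_poly_normal P; rewrite PE {PE}.
have hC c : \det (horner_mx A c%:P) = \prod_(r <- rs) (c%:P).[r].
  rewrite horner_mx_C det_scalar; under eq_bigr do rewrite hornerC.
  by rewrite big_const_seq count_predT rsn iter_mulr_1.
rewrite -mul_polyC rmorphM det_mulmx hC.
under [RHS]eq_bigr do rewrite hornerM.
rewrite big_split/=; congr (_ * _).
elim: bs => [|b bs IHbs].
  by rewrite big_nil -polyC1 hC.
rewrite big_cons rmorphM det_mulmx IHbs.
under [RHS]eq_bigr do rewrite hornerM.
rewrite big_split/=; congr (_ * _).
have /(congr1 (fun f : {poly F} => f.[b])) := Ars.
rewrite horner_prod; under [X in _ = X -> _]eq_bigr do rewrite hornerXsubC -opprB -mulN1r.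
rewrite big_split/= big_const_seq count_predT rsn iter_mulr_1 => Ab.
under eq_bigr do rewrite hornerXsubC.
rewrite rmorphB/= horner_mx_X horner_mx_C -opprB -scaleN1r detZ.
have <- : (char_poly A).[b] = \det (b%:M - A).
  rewrite -horner_evalE -det_map_mx; congr (\det _).
  apply/matrixP => i j; rewrite !mxE /= /horner_eval hornerD hornerN !hornerC.
  by rewrite hornerMn hornerX.
by rewrite Ab mulrA -exprMn mulrNN mulr1 expr1n mul1r.
Qed.

(** * Estimates at 0+ *)

Section BigO.
Variable R : realType.
Local Notation C := R[i].
Implicit Types (f g : R -> C) (z w : C).

Lemma normCE z : `|z| = (normc z)%:C%C. Proof. by []. Qed.

Lemma normc_ge0 z : 0 <= normc z.
Proof. by case: z => a b; exact: sqrtr_ge0. Qed.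

Lemma normcX z k : normc (z ^+ k) = normc z ^+ k.
Proof. by elim: k => [|k IHk]; rewrite ?normc1// !exprS normcM IHk. Qed.

Lemma normc_real (x : R) : normc x%:C%C = `|x|.
Proof. by rewrite /normc/= expr0n/= addr0 sqrtr_sqr. Qed.

Lemma le_normcB z w : normc z - normc w <= normc (z - w).
Proof. by rewrite lerBlDr (le_trans _ (le_normcD _ _))// subrK. Qed.

Lemma le_normc_sum (J : Type) (r : seq J) (P : pred J) (F : J -> C) :
  normc (\sum_(j <- r | P j) F j) <= \sum_(j <- r | P j) normc (F j).
Proof.
elim/big_ind2 : _ => //; first by rewrite normc0.
by move=> z1 x1 z2 x2 h1 h2; rewrite (le_trans (le_normcD _ _))// lerD.
Qed.

Lemma normc_prod (J : Type) (r : seq J) (P : pred J) (F : J -> C) :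
  normc (\prod_(j <- r | P j) F j) = \prod_(j <- r | P j) normc (F j).
Proof. exact: (big_morph _ (@normcM R) (@normc1 R)). Qed.

(* f(t) = O(t^k) as t tends to 0 from the right. *)
Definition Opow k f := exists M : R, \forall t \near 0^'+, normc (f t) <= M * t ^+ k.

Lemma near_Opow f g k : (\forall t \near 0^'+, f t = g t) -> Opow k f -> Opow k g.
Proof.
move=> fg [M fM]; exists M.
by apply: filterS2 fg fM => t <-.
Qed.

Lemma eq_Opow f g k : f =1 g -> Opow k f -> Opow k g.
Proof. by move=> fg; apply: near_Opow; exact: nearW. Qed.

Lemma Opow_cst z : Opow 0 (fun=> z).
Proof. by exists (normc z); apply: nearW => t; rewrite expr0 mulr1. Qed.

Lemma Opow_var : Opow 1 (fun t => t%:C%C).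
Proof.
exists 1; near=> t; rewrite normc_real expr1 mul1r ger0_norm//.
Unshelve. all: by end_near. Qed.

Lemma OpowD f g k : Opow k f -> Opow k g -> Opow k (fun t => f t + g t).
Proof.
move=> [M fM] [N gN]; exists (M + N).
apply: filterS2 fM gN => t ft gt.
by rewrite (le_trans (le_normcD _ _))// mulrDl lerD.
Qed.

Lemma OpowM f g k l : Opow k f -> Opow l g -> Opow (k + l) (fun t => f t * g t).
Proof.
move=> [M fM] [N gN]; exists (M * N).
apply: filterS2 fM gN => t ft gt.
by rewrite normcM exprD mulrACA ler_pM ?normc_ge0.
Qed.

Lemma OpowN f k : Opow k f -> Opow k (fun t => - f t).
Proof. by move=> [M fM]; exists M; apply: filterS fM => t; rewrite normcN. Qed.

Lemma OpowB f g k : Opow k f -> Opow k g -> Opow k (fun t => f t - g t).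
Proof. by move=> fO /OpowN; exact: OpowD. Qed.

Lemma leq_Opow f k l : (k <= l)%N -> Opow l f -> Opow k f.
Proof.
move=> kl [M fM]; exists `|M|; near=> t.
have t0 : 0 < t by near: t; exact: nbhs_right_gt.
have t1 : t < 1 by near: t; exact: nbhs_right_lt.
apply: (@le_trans _ _ (M * t ^+ l)); first by near: t.
apply: (@le_trans _ _ (`|M| * t ^+ l)).
  by rewrite ler_pM2r ?exprn_gt0// ler_norm.
by rewrite ler_wpM2l// ler_wiXn2l// ltW.
Unshelve. all: by end_near. Qed.

Lemma Opow_sum (J : Type) (r : seq J) (F : J -> R -> C) k :
  (forall j, Opow k (F j)) -> Opow k (fun t => \sum_(j <- r) F j t).
Proof.
move=> FO; elim: r => [|j r IHr].
  apply: (@eq_Opow (fun=> 0)) => [t|]; first by rewrite big_nil.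
  by exists 0; apply: nearW => t; rewrite normc0 mul0r.
by apply: (eq_Opow _ (OpowD (FO j) IHr)) => t; rewrite big_cons.
Qed.

Lemma Opow_exp k : Opow k (fun t => t%:C%C ^+ k).
Proof.
elim: k => [|k IHk]; first exact: Opow_cst.
by apply: (eq_Opow _ (OpowM Opow_var IHk)) => t; rewrite exprS.
Qed.

Lemma Opow_horner (p : {poly C}) : Opow 0 (fun t => p.[t%:C%C]).
Proof.
apply: (@eq_Opow (fun t => \sum_(i < size p) p`_i * t%:C%C ^+ i)) => [t|].
  by rewrite horner_coef.
apply: Opow_sum => i; apply: (OpowM (Opow_cst _)).
exact: leq_Opow (Opow_exp i).
Qed.

Lemma Opow1_cst z : Opow 1 (fun=> z) -> z = 0.
Proof.
move=> [M zM]; apply: eq0_normc; apply: le_anti; rewrite normc_ge0 andbT.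
rewrite leNgt; apply/negP => z0.
near (0 : R)^'+ => t.
have t0 : 0 < t by near: t; exact: nbhs_right_gt.
have : normc z <= M * t ^+ 1 by near: t.
apply/negP; rewrite -ltNge expr1.
have tM : t < normc z / (`|M| + 1).
  by near: t; apply: nbhs_right_lt; rewrite divr_gt0// ltr_pwDr.
rewrite ltr_pdivlMr ?ltr_pwDr// in tM.
apply: le_lt_trans tM; rewrite mulrC ler_pM2l//.
by rewrite (le_trans (ler_norm _))// lerDl.
Unshelve. all: by end_near. Qed.

(** The constant term is O(t), hence zero; a factor t > 0 then cancels. *)
Lemma Opow_poly_coef (p : {poly C}) k :
  Opow k (fun t => p.[t%:C%C]) -> forall i, (i < k)%N -> p`_i = 0.
Proof.
elim: k p => [//|k IHk] p pO.
have [q pE] : exists q, p = q * 'X + (p`_0)%:P.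
  have /factor_theorem[q qE] : root (p - (p`_0)%:P) 0.
    by apply/rootP; rewrite hornerD hornerN hornerC horner_coef0 subrr.
  by exists q; apply/eqP; rewrite -subr_eq qE polyC0 subr0.
have pE' t : p.[t] = q.[t] * t + p`_0 by rewrite [in LHS]pE !hornerE.
have p0 : p`_0 = 0.
  apply: Opow1_cst; have qO := OpowM (Opow_horner q) Opow_var.
  by apply: (eq_Opow _ (OpowB (leq_Opow _ pO) qO)) => // t; rewrite pE' addrC addKr.
have qO : Opow k (fun t => q.[t%:C%C]).
  have [M pM] := pO; exists M; near=> t.
  have t0 : 0 < t by near: t; exact: nbhs_right_gt.
  have : normc p.[t%:C%C] <= M * t ^+ k.+1 by near: t.
  rewrite pE' p0 addr0 normcM normc_real (gtr0_norm t0) exprSr mulrA.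
  by rewrite ler_pM2r.
move=> [//|i] ik; rewrite pE p0 polyC0 addr0 coefMX/=; exact: IHk qO _ _.
Unshelve. all: by end_near. Qed.

End BigO.

(** * Taylor truncations of convergent power series *)

Section Analytic.
Variable R : realType.
Local Notation C := R[i].
Implicit Types (z w : C).

Lemma gt0C_real (e : C) : 0 < e -> exists2 d : R, 0 < d & e = d%:C%C.
Proof.
move=> e0; have eE := RRe_real (gtr0_real e0).
by exists (complex.Re e) => //; rewrite -ltcR eE.
Qed.

Lemma nearC_ball (a : C) (P : C -> Prop) : (\forall z \near (a : C^o), P z) ->
  exists2 d : R, 0 < d & forall z, normc (a - z) < d -> P z.
Proof.
move=> /nbhs_ballP[e /= /gt0C_real[d d0 ->] dP]; exists d => // z zd.
by apply: dP; rewrite -ball_normE /ball_/= normCE ltcR.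
Qed.

Lemma near0C_ball (P : C -> Prop) : (\forall z \near (0 : C^o), P z) ->
  exists2 d : R, 0 < d & forall z, normc z < d -> P z.
Proof.
move=> /nearC_ball[d d0 dP]; exists d => // z zd.
by apply: dP; rewrite sub0r normcN.
Qed.

Lemma near00C_ball (P : C * C -> Prop) : (\forall z \near ((0, 0) : C^o * C^o), P z) ->
  exists2 d : R, 0 < d & forall z w, normc z < d -> normc w < d -> P (z, w).
Proof.
move=> /nbhs_ballP[e /= /gt0C_real[d d0 ->] dP]; exists d => // z w zd wd.
by apply: dP; split; rewrite /= -ball_normE /ball_/= sub0r normrN normCE ltcR.
Qed.

Lemma cvgC_dist (u : nat -> C) (l : C) : (u : nat -> C^o) @ \oo --> (l : C^o) ->
  forall e : R, 0 < e -> exists N, forall n, (N <= n)%N -> normc (l - u n) < e.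
Proof.
move=> /cvgrPdist_lt ul e e0.
have /ul[N _ Nu] : 0 < e%:C%C by rewrite ltcR.
by exists N => n Nn; have := Nu n Nn; rewrite /= normCE ltcR.
Qed.

Lemma normc_lim_le (u : nat -> C) (l z : C) (B : R) k :
  (u : nat -> C^o) @ \oo --> (l : C^o) ->
  (forall n, (k <= n)%N -> normc (u n - z) <= B) -> normc (l - z) <= B.
Proof.
move=> ul uB; apply/ler_addgt0Pr => e e0.
have [N Nu] := cvgC_dist ul e0.
have -> : l - z = (u (maxn k N) - z) + (l - u (maxn k N)) by ring.
rewrite (le_trans (le_normcD _ _))// lerD ?uB ?leq_maxl// ltW//.
by rewrite Nu// leq_maxr.
Qed.

Lemma geometric_sum_le (q : R) n : 0 <= q -> q <= 2^-1 -> \sum_(i < n) q ^+ i <= 2.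
Proof.
move=> q0 q2; elim: n => [|n IHn]; first by rewrite big_ord0.
rewrite big_ord_recl expr0.
under eq_bigr do rewrite lift0 exprS.
rewrite -mulr_sumr; have : q * \sum_(i < n) q ^+ i <= 2^-1 * 2.
  by rewrite ler_pM// sumr_ge0// => i _; rewrite exprn_ge0.
by lra.
Qed.

Lemma series_terms_bounded (c : nat -> C) (r : R) (l : C) : 0 < r ->
  series (fun k => c k * r%:C%C ^+ k : C^o) @ \oo --> (l : C^o) ->
  exists2 M : R, 0 <= M & forall k, normc (c k) * r ^+ k <= M.
Proof.
move=> r0 cl; have [N Nc] := cvgC_dist cl ltr01.
(* The 2 bounds each term beyond [N], a difference of two partial sums within 1 of the limit. *)
exists (2 + \sum_(i < N) normc (c i) * r ^+ i).
  by rewrite addr_ge0// sumr_ge0// => i _; rewrite mulr_ge0 ?normc_ge0 ?exprn_ge0 ?ltW.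
move=> k; have [kN|Nk] := ltnP k N.
  rewrite (bigD1 (Ordinal kN))//= addrCA lerDl addr_ge0// sumr_ge0// => i _.
  by rewrite mulr_ge0 ?normc_ge0 ?exprn_ge0 ?ltW.
rewrite -[leLHS]addr0 lerD//; last first.
  by rewrite sumr_ge0// => i _; rewrite mulr_ge0 ?normc_ge0 ?exprn_ge0 ?ltW.
have -> : normc (c k) * r ^+ k = normc (c k * r%:C%C ^+ k).
  by rewrite normcM normcX normc_real gtr0_norm.
have := Nc _ (leqW Nk); have := Nc _ Nk.
rewrite /series/= big_nat_recr//=; set S := \sum_(0 <= _ < _) _ => h1 h2.
have -> : c k * r%:C%C ^+ k = (l - S) - (l - (S + c k * r%:C%C ^+ k)) by ring.
rewrite (le_trans (le_normcD _ _))// normcN.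
by rewrite (le_trans (lerD (ltW h1) (ltW h2)))// -natr1.
Qed.

(** For r inside the disk of convergence |c_i| r^i is bounded, so for |z| < r / 2 the tail is
    dominated by a geometric series of ratio at most 1/2. *)
Lemma analytic_at0_trunc (f : C -> C) : analytic_at0 f ->
  exists c : nat -> C, forall k, exists M : R, exists2 d : R, 0 < d &
    forall z, normc z < d ->
      normc (f z - \sum_(i < k) c i * z ^+ i) <= M * normc z ^+ k.
Proof.
move=> [c /near0C_ball[d d0 fc]]; exists c => k.
have [r r0 rd] : exists2 r, 0 < r & r < d by exists (d / 2); lra.
have [|M M0 cM] := @series_terms_bounded c r (f r%:C%C) r0.
  by apply: fc; rewrite normc_real gtr0_norm.
exists (M * 2 / r ^+ k); exists (r / 2); first by rewrite divr_gt0.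
move=> z zr; apply: (normc_lim_le (k := k)); first by apply: fc; lra.
move=> n kn; rewrite /series/= big_mkord.
rewrite (big_ord_widen n (fun i => c i * z ^+ i) kn) [X in X - _](bigID (fun i : 'I_n =>
  (i < k)%N))/= addrAC subrr add0r.
rewrite (le_trans (le_normc_sum _ _ _))//.
pose q := normc z / r.
have q0 : 0 <= q by rewrite divr_ge0 ?normc_ge0 ?ltW.
have q2 : q <= 2^-1 by rewrite ler_pdivrMr//; lra.
apply: (@le_trans _ _ (\sum_(i < n | ~~ (i < k)%N) M * q ^+ i)).
  apply: ler_sum => i _; rewrite normcM normcX expr_div_n mulrA ler_pdivlMr ?exprn_gt0//.
  by rewrite mulrAC ler_wpM2r ?exprn_ge0 ?normc_ge0.
rewrite -mulr_sumr.
have -> : \sum_(i < n | ~~ (i < k)%N) q ^+ i = q ^+ k * \sum_(i < n - k) q ^+ i.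
  rewrite -(big_mkord (fun i => ~~ (i < k)%N)) (big_cat_nat _ kn)//= big_nat_cond big1
    ?add0r; last first.
    by move=> i /andP[/andP[_ ->]].
  rewrite -{1}[k]add0n big_addn big_mkord mulr_sumr; apply: eq_big => i.
    by rewrite -leqNgt leq_addl.
  by rewrite addnC exprD.
rewrite /q expr_div_n -/q.
have -> : M * 2 / r ^+ k * normc z ^+ k = M * (normc z ^+ k / r ^+ k * 2) by ring.
rewrite ler_wpM2l// ler_wpM2l ?geometric_sum_le//.
by rewrite divr_ge0 ?exprn_ge0 ?normc_ge0// ltW.
Qed.

(** Absolute convergence at (r, r) bounds the whole sum of |c_ij| r^(i+j). A discarded monomial has
    i + j >= k and therefore gains a factor (rho / r)^k. *)
Lemma analytic_at00_trunc (f : C -> C -> C) : analytic_at00 f ->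
  exists c : nat -> nat -> C, forall k, exists M : R, exists2 d : R, 0 < d &
    forall z w (rho : R), normc z <= rho -> normc w <= rho -> rho < d ->
      normc (f z w - \sum_(i < k) \sum_(j < k) c i j * z ^+ i * w ^+ j) <= M * rho ^+ k.
Proof.
move=> [c /near00C_ball[d d0 fc]]; exists c => k.
have [r r0 rd] : exists2 r, 0 < r & r < d by exists (d / 2); lra.
have rr : normc r%:C%C < d by rewrite normc_real gtr0_norm.
have [/= cvT _] := fc _ _ rr rr.
pose T n : R := \sum_(i < n) \sum_(j < n) normc (c i j) * r ^+ i * r ^+ j.
have TE n : \sum_(i < n) \sum_(j < n) `|c i j * r%:C%C ^+ i * r%:C%C ^+ j| = (T n)%:C%C
  :> C.
  rewrite /T rmorph_sum; apply: eq_bigr => i _; rewrite rmorph_sum; apply: eq_bigr => j _.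
  by rewrite normCE !normcM !normcX normc_real gtr0_norm.
have t0 i j : 0 <= normc (c i j) * r ^+ i * r ^+ j.
  by rewrite !mulr_ge0 ?normc_ge0 ?exprn_ge0// ltW.
have [M TM] : exists M, forall n, T n <= M.
  have [N NT] := cvgC_dist cvT ltr01.
  set l := lim _ in NT; exists (normc l + 1) => n.
  have /NT : (N <= maxn n N)%N by rewrite leq_maxr.
  rewrite TE => lT.
  apply: (@le_trans _ _ (T (maxn n N))).
    rewrite /T (big_ord_widen _ (fun i =>
      \sum_(j < n) normc (c i j) * r ^+ i * r ^+ j) (leq_maxl n N)).
    rewrite [leRHS](bigID (fun i : 'I__ => (i < n)%N))/= -[leLHS]addr0 lerD//.
      apply: ler_sum => i _.
      rewrite (big_ord_widen _ (fun j => normc (c i j) * r ^+ i * r ^+ j) (leq_maxl n N)).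
      rewrite [leRHS](bigID (fun i : 'I__ => (i < n)%N))/= -[leLHS]addr0 lerD//.
      by rewrite sumr_ge0.
    by rewrite sumr_ge0// => i _; rewrite sumr_ge0.
  have := le_normcB (T (maxn n N))%:C%C l; rewrite -[X in _ <= X]normcN opprB => h.
  have := ler_norm (T (maxn n N)); rewrite -normc_real; lra.
exists (M / r ^+ k); exists r => // z w rho zr wr rhor.
have rho0 : 0 <= rho := le_trans (normc_ge0 _) zr.
have zd : normc z < d by lra.
have wd : normc w < d by lra.
have [_ /= cvS] := fc _ _ zd wd.
apply: (normc_lim_le (k := k)) cvS _ => n kn.
have -> : \sum_(i < k) \sum_(j < k) c i j * z ^+ i * w ^+ j =
    \sum_(i < n) \sum_(j < n) (if (i < k)%N && (j < k)%N then c i j * z ^+ i * w ^+ j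
      else 0).
  rewrite (big_ord_widen _ (fun i =>
    \sum_(j < k) c i j * z ^+ i * w ^+ j) kn) big_mkcond; apply: eq_bigr => i _.
  case: (i < k)%N; last by rewrite big1.
  by rewrite (big_ord_widen _ (fun j => c i j * z ^+ i * w ^+ j) kn) big_mkcond.
rewrite -sumrB; under eq_bigr do rewrite -sumrB.
apply: (@le_trans _ _ (\sum_(i < n) \sum_(j < n) normc (c i j) * r ^+ i * r ^+ j * (rho /
  r) ^+ k)); last first.
  under eq_bigr do rewrite -mulr_suml.
  rewrite -mulr_suml (_ : M / r ^+ k * rho ^+ k = M * (rho / r) ^+ k).
    by apply: ler_wpM2r; [rewrite exprn_ge0// divr_ge0// ltW|exact: TM].
  by rewrite expr_div_n mulrAC -mulrA.
rewrite (le_trans (le_normc_sum _ _ _))//; apply: ler_sum => i _.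
rewrite (le_trans (le_normc_sum _ _ _))//; apply: ler_sum => j _.
case: ifPn => [_|ij]; first by rewrite subrr normc0 mulr_ge0// exprn_ge0// divr_ge0// ltW.
have kij : (k <= i + j)%N.
  by move: ij; rewrite negb_and -!leqNgt => /orP[ki|kj];
    [exact: leq_trans ki (leq_addr _ _)|exact: leq_trans kj (leq_addl _ _)].
rewrite subr0 !normcM !normcX.
apply: (@le_trans _ _ (normc (c i j) * r ^+ i * r ^+ j * (rho / r) ^+ (i + j))); last first.
  apply: ler_wpM2l => //; apply: ler_wiXn2l => //; first by rewrite divr_ge0// ltW.
  by rewrite ler_pdivrMr// mul1r ltW.
rewrite expr_div_n exprD exprD.
have ri : r ^+ i != 0 by rewrite expf_neq0// gt_eqF.
have rj : r ^+ j != 0 by rewrite expf_neq0// gt_eqF.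
have -> : normc (c i j) * r ^+ i * r ^+ j * (rho ^+ i * rho ^+ j / (r ^+ i * r ^+ j)) =
   normc (c i j) * rho ^+ i * rho ^+ j by field; rewrite ri rj.
by rewrite !ler_pM ?mulr_ge0 ?exprn_ge0 ?normc_ge0// lerXn2r// nnegrE ?normc_ge0.
Qed.

End Analytic.

(** * Branches and contact orders *)

Section RootsOfUnity.
Variable R : realType.
Local Notation C := R[i].

Lemma expiD (a b : R) : expi (a + b) = expi a * expi b.
Proof. by rewrite /expi cosD sinD; simpc; rewrite [X in (_ +i* X)%C]addrC. Qed.

Lemma expi0 : expi 0 = 1 :> C.
Proof. by rewrite /expi cos0 sin0. Qed.

Lemma expiMn (a : R) n : expi (a * n%:R) = expi a ^+ n.
Proof.
elim: n => [|n IHn]; first by rewrite mulr0 expi0.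
by rewrite -natr1 mulrDr mulr1 expiD IHn exprSr.
Qed.

Lemma expi2pi : expi (2 * pi) = 1 :> C.
Proof. by rewrite mulr_natl /expi cos2pi sin2pi. Qed.

Definition unity_root (N j : nat) : C := expi (2 * pi * j%:R / N%:R).

Lemma unity_rootE N j : unity_root N j = unity_root N 1 ^+ j.
Proof. by rewrite /unity_root -expiMn; congr expi; rewrite mulr1 mulrAC. Qed.

Lemma unity_root_exp N j : (0 < N)%N -> unity_root N j ^+ N = 1.
Proof.
move=> N0; rewrite /unity_root -expiMn divfK ?pnatr_eq0 -?lt0n//.
by rewrite expiMn expi2pi expr1n.
Qed.

(** If the order d were less than N, the real part of exp(2 pi i d / N) = 1 would be 1 - 2 sin(pi d
    / N)^2 < 1. *)
Lemma unity_root_primitive N : (0 < N)%N -> N.-primitive_root (unity_root N 1).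
Proof.
move=> N0; have [d dprim dN] := prim_order_exists N0 (unity_root_exp 1 N0).
have d0 := prim_order_gt0 dprim.
have [dN'|dN'] := eqVneq d N; first by rewrite -[X in X.-primitive_root _]dN'.
have dltN : (d < N)%N by rewrite ltn_neqAle dN' dvdn_leq.
have /(congr1 (@complex.Re R))/= := prim_expr_order dprim.
rewrite -unity_rootE/=; pose a : R := pi * d%:R / N%:R.
have -> : 2 * pi * d%:R / N%:R = a *+ 2 by rewrite /a mulr2n; ring.
rewrite cos_mulr2n cos2sin2.
have : 0 < sin a.
  apply: sin_gt0_pi; rewrite /a divr_gt0 ?mulr_gt0 ?pi_gt0 ?ltr0n//=.
  by rewrite ltr_pdivrMr ?ltr0n// ltr_pM2l ?pi_gt0// ltr_nat.
by move=> s0; have := exprn_gt0 2 s0; lra.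
Qed.

Lemma eq_exp_unity_root N (s : C) (x : R) : (0 < N)%N -> 0 < x ->
  s ^+ N = x%:C%C ^+ N -> exists2 j, (j < N)%N & s = unity_root N j * x%:C%C.
Proof.
move=> N0 x0 sx; have x0' : x%:C%C != 0 by rewrite eq_complex/= gt_eqF.
have /(prim_rootP (unity_root_primitive N0))[j jE] : (s / x%:C%C) ^+ N = 1.
  by rewrite expr_div_n sx divff// expf_neq0.
by exists j => //; rewrite unity_rootE -jE divfK.
Qed.

Lemma exists_root N (t : R) : (0 < N)%N -> 0 < t ->
  exists2 x : R, 0 < x & x ^+ N = t.
Proof.
move=> N0 t0; have : 0 < N.-root t%:C%C by rewrite rootC_gt0// ltcR.
move=> /gt0C_real[x x0 xE]; exists x => //.
by apply: complexI; rewrite rmorphXn/= -xE rootCK.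
Qed.

Lemma principal_root_exp N (x : R) : (0 < N)%N -> 0 < x ->
  principal_root N (x%:C%C ^+ N) = x%:C%C.
Proof.
move=> N0 x0; rewrite /principal_root -rmorphXn -complexIm/= lexx.
by rewrite rmorphXn exprCK//; rewrite lecR ltW.
Qed.

End RootsOfUnity.

Section Beta.
Variable R : realType.
Local Notation C := R[i].
Implicit Types (w : C) (t : R).

Lemma normc_sqr w : normc w ^+ 2 = complex.Re w ^+ 2 + complex.Im w ^+ 2.
Proof. by case: w => a b; rewrite /normc sqr_sqrtr// addr_ge0// sqr_ge0. Qed.

Lemma normci : normc ('i : C) = 1.
Proof. by rewrite -complexiE /= expr0n expr1n add0r sqrtr1. Qed.

Lemma normc_1iw w : normc w <= 2^-1 -> 2^-1 <= normc (1 - 'i * w) <= 3 / 2.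
Proof.
move=> w2; have := le_normcB 1 ('i * w); have := le_normcD 1 (- ('i * w)).
by rewrite normcN normcM normci mul1r normc1; lra.
Qed.

(** This is |1 - iw|^2 - |1 + iw|^2 = 4 Im w, the reason why beta maps the upper half-plane to the
    disk. *)
Lemma normc_beta w : normc w <= 2^-1 ->
  (1 - normc (beta w)) * (1 + normc (beta w)) * normc (1 - 'i * w) ^+ 2 =
  4 * complex.Im w.
Proof.
move=> /normc_1iw/andP[n0 _].
have -> : normc (beta w) = normc (1 + 'i * w) / normc (1 - 'i * w).
  by rewrite /beta normcM normcV.
have -> : (1 - normc (1 + 'i * w) / normc (1 - 'i * w)) *
    (1 + normc (1 + 'i * w) / normc (1 - 'i * w)) * normc (1 - 'i * w) ^+ 2 =
    normc (1 - 'i * w) ^+ 2 - normc (1 + 'i * w) ^+ 2 by field; lra.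
rewrite !normc_sqr -complexiE; case: w {n0} => a b /=; ring.
Qed.

(** In [normc_beta] the factor 1 + |beta w| lies between 1 and 2, and |1 - iw|^2 between 1/4 and
    9/4. *)
Lemma beta_Im w : normc w <= 2^-1 -> 0 <= 1 - normc (beta w) ->
  16^-1 * (1 - normc (beta w)) <= complex.Im w <= 3 * (1 - normc (beta w)).
Proof.
move=> w2; have := normc_beta w2; have /andP := normc_1iw w2.
have := normc_ge0 (beta w).
set n := normc (1 - _); set b := normc (beta w); set y := complex.Im w.
move=> b0 [n1 n2] E a0; apply/andP; split.
  have n4 : 4^-1 <= n ^+ 2 by nra.
  have am : 1 - b <= (1 - b) * (1 + b) by nra.
  have : (1 - b) * (1 + b) * 4^-1 <= (1 - b) * (1 + b) * n ^+ 2.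
    by rewrite ler_wpM2l// (le_trans a0 am).
  by lra.
have n4 : n ^+ 2 <= 9 / 4 by nra.
have am : (1 - b) * (1 + b) <= (1 - b) * 2 by nra.
have : (1 - b) * (1 + b) * n ^+ 2 <= (1 - b) * 2 * (9 / 4).
  by rewrite ler_pM ?sqr_ge0// mulr_ge0//; lra.
by lra.
Qed.

Lemma beta_real_neq0 t : 1 - 'i * t%:C%C != 0 :> C.
Proof. by rewrite -complexiE eq_complex/=; apply/nandP; left; simpc; rewrite oner_eq0. Qed.

Lemma normc_beta_real t : normc (beta t%:C%C) = 1.
Proof.
rewrite /beta normcM normcV -complexiE /=; simpc => /=.
by rewrite sqrrN divff// sqrtr_eq0 -ltNge expr1n ltr_pwDl ?sqr_ge0.
Qed.

Lemma beta_invK t : beta_inv (beta t%:C%C) = t%:C%C.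
Proof.
have := beta_real_neq0 t; rewrite /beta_inv /beta.
have : 'i ^+ 2 = -1 :> C by exact: sqrCi.
move: ('i : C) (t%:C%C) => j s j2 n0.
have -> : 1 - (1 + j * s) / (1 - j * s) = - 2 * j * s / (1 - j * s) by field.
have -> : 1 + (1 + j * s) / (1 - j * s) = 2 / (1 - j * s) by field.
have -> : j * (- 2 * j * s / (1 - j * s)) / (2 / (1 - j * s)) = - j ^+ 2 * s by field.
by rewrite j2 opprK mul1r.
Qed.

Lemma normc_1beta t : 0 < t -> t <= 2^-1 -> t <= normc (1 - beta t%:C%C) <= 4 * t.
Proof.
move=> t0 t2; have t2' : normc t%:C%C <= 2^-1 by rewrite normc_real gtr0_norm.
have /andP[n1 n2] := normc_1iw t2'.
have n0 := beta_real_neq0 t.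
have -> : 1 - beta t%:C%C = - 2 * 'i * t%:C%C / (1 - 'i * t%:C%C) by rewrite /beta; field.
rewrite !normcM normcN normcV normci mulr1 normc_real (gtr0_norm t0).
have -> : normc 2 = 2 :> R.
  by rewrite -(rmorph_nat (real_complex R)) normc_real ger0_norm.
by rewrite ler_pdivlMr 1?ler_pdivrMr; nra.
Qed.

End Beta.

Section Contact.
Variable R : realType.
Local Notation C := R[i].
Implicit Types (Psi : C -> C) (N j K : nat).

Lemma analytic_at0_small Psi (u : C) : analytic_at0 Psi -> Psi 0 = 0 ->
  forall e, 0 < e -> \forall t \near 0^'+, normc (Psi (u * t%:C%C)) <= e.
Proof.
move=> /analytic_at0_trunc[c cPsi] Psi0 e e0.
have [M [d d0 PsiM]] := cPsi 1%N.
have c0 : c 0%N = 0.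
  have := PsiM 0; rewrite normc0 big_ord1 expr0 expr1 mulr0 mulr1 Psi0 sub0r normcN.
  by move=> /(_ d0) h; apply: eq0_normc; apply/eqP; rewrite eq_le h normc_ge0.
have uM0 : 0 < normc u + 1 by rewrite ltr_pwDr ?normc_ge0.
have M1 : 0 < `|M| + 1 by rewrite ltr_pwDr.
near=> t.
have t0 : 0 < t by near: t; exact: nbhs_right_gt.
have ut : normc (u * t%:C%C) <= (normc u + 1) * t.
  by rewrite normcM normc_real gtr0_norm// ler_pM2r// lerDl.
have td : t < d / (normc u + 1).
  by near: t; apply: nbhs_right_lt; rewrite divr_gt0.
have utd : normc (u * t%:C%C) < d.
  by apply: le_lt_trans ut _; rewrite ltr_pdivlMr// mulrC in td.
have := PsiM _ utd; rewrite big_ord1 c0 mul0r subr0 expr1 => h.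
have te : t < e / ((`|M| + 1) * (normc u + 1)).
  by near: t; apply: nbhs_right_lt; rewrite divr_gt0// mulr_gt0.
have M0 : 0 <= `|M| by [].
have hM : M * normc (u * t%:C%C) <= `|M| * normc (u * t%:C%C).
  by rewrite ler_wpM2r ?normc_ge0// ler_norm.
have hM' : `|M| * normc (u * t%:C%C) <= `|M| * ((normc u + 1) * t) by rewrite ler_wpM2l.
rewrite ltr_pdivlMr ?mulr_gt0// in te.
have ut0 : 0 <= (normc u + 1) * t by rewrite mulr_ge0// ltW.
by lra.
Unshelve. all: by end_near. Qed.

(** Here t is the real N-th root of w2: the point z2 = beta(t^N) is on the circle at a distance of
    order t^N from 1, and 1 - |psi| is comparable with the imaginary part of [Psi]. Hence the
    exponent N K. *)
Lemma contact_order_Im N j Psi K : (0 < N)%N -> analytic_at0 Psi -> Psi 0 = 0 ->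
  contact_order (branch N Psi j) K ->
  exists2 c : R, 0 < c & \forall t \near 0^'+,
    c * t ^+ (N * K) <= complex.Im (Psi (unity_root R N j * t%:C%C)) /\
    c * complex.Im (Psi (unity_root R N j * t%:C%C)) <= t ^+ (N * K).
Proof.
move=> N0 Psia Psi0 [_ [c [/gt0C_real[c0 c00 ->] /nearC_ball[d d0 dK]]]].
(* The lower bound costs the 16 of [beta_Im], the upper bound its 3 and the 4 of [normc_1beta]; one
   constant serves for both. *)
pose e := (16 * c0 * 4 ^+ K)^-1.
exists e; first by rewrite invr_gt0 !mulr_gt0// exprn_gt0.
near=> l.
have l0 : 0 < l by near: l; exact: nbhs_right_gt.
have w2 : normc (Psi (unity_root R N j * l%:C%C)) <= 2^-1.
  by near: l; apply: analytic_at0_small => //; rewrite invr_gt0.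
pose t := l ^+ N.
have t0 : 0 < t by rewrite exprn_gt0.
have l1 : l < 1 by near: l; exact: nbhs_right_lt.
have lt : t <= l.
  rewrite /t -(prednK N0) exprS ler_piMr ?(ltW l0)//.
  by apply: exprn_ile1; exact: ltW.
have l2 : l < 2^-1 by near: l; apply: nbhs_right_lt; rewrite invr_gt0.
have ld : l < d / 4 by near: l; apply: nbhs_right_lt; rewrite divr_gt0.
have /normc_1beta/(_ _)/andP[|r1 r2] := t0; first by lra.
have bd : normc (1 - beta t%:C%C) < d by lra.
have b1 : `|beta t%:C%C| = 1 by rewrite normCE normc_beta_real.
have := dK _ bd b1.
rewrite /branch beta_invK /t rmorphXn principal_root_exp// -rmorphXn -/t.
rewrite -/(unity_root R N j); set w := Psi _ in w2 *.
rewrite !normCE -(rmorph1 (real_complex R)) -rmorphB -!rmorphXn -!rmorphM !lecR.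
set y := normc (1 - _) in r1 r2 *; set A := 1 - _ => -[h1 h2].
have yK0 : 0 <= y ^+ K by rewrite exprn_ge0 ?normc_ge0.
have A0 : 0 <= A by rewrite -(pmulr_rge0 _ c00) (le_trans yK0).
have /andP[i1 i2] := beta_Im w2 A0; rewrite -/A in i1 i2.
have K40 : 1 <= 4 ^+ K :> R by rewrite exprn_ege1//; lra.
have tK0 : 0 < t ^+ K by rewrite exprn_gt0.
have tyK : t ^+ K <= y ^+ K by rewrite lerXn2r ?nnegrE ?normc_ge0// ltW.
have ytK : y ^+ K <= 4 ^+ K * t ^+ K.
  by rewrite -exprMn lerXn2r ?nnegrE ?normc_ge0// mulr_ge0// ltW.
have e0 : 0 < 16 * c0 * 4 ^+ K by rewrite !mulr_gt0// exprn_gt0.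
rewrite exprM -/t /e; split.
  rewrite mulrC ler_pdivrMr//.
  have : t ^+ K <= c0 * A by lra.
  have : c0 * (16^-1 * A) <= c0 * complex.Im w by rewrite ler_pM2l.
  have : c0 * complex.Im w * 1 <= c0 * complex.Im w * 4 ^+ K.
    rewrite ler_wpM2l// mulr_ge0 ?(ltW c00)//.
    by rewrite (le_trans _ i1)// mulr_ge0.
  by lra.
rewrite mulrC ler_pdivrMr//.
have : c0 * y ^+ K <= c0 * (4 ^+ K * t ^+ K) by rewrite ler_pM2l.
have : 0 <= c0 * (4 ^+ K * t ^+ K) by rewrite !mulr_ge0 ?(ltW c00) ?(ltW tK0)//; lra.
by lra.
Unshelve. all: by end_near. Qed.

End Contact.

Section ContactUnique.
Variable R : realType.
Local Notation C := R[i].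
Implicit Types (Psi : C -> C) (N j K : nat).

Lemma normc_conj (z : C) : normc (z^*)%C = normc z.
Proof. by case: z => a b; rewrite /normc /= sqrrN. Qed.

Lemma Opow_conj (f : R -> C) k : Opow k f -> Opow k (fun t => (f t)^*)%C.
Proof. by move=> [M fM]; exists M; apply: filterS fM => t; rewrite normc_conj. Qed.

Lemma normc_subcJ (z : C) : normc (z - z^*%C) = 2 * `|complex.Im z|.
Proof.
rewrite subcJ !normcM normc_real complexiE normci mulr1.
by rewrite -(rmorph_nat (real_complex R)) normc_real ger0_norm.
Qed.

(** The difference is 2i times the imaginary part of [Psi], so for real t its Taylor coefficients
    vanish exactly where those of [Psi] along [u] are real. *)
Lemma analytic_at0_conj_expansion Psi : analytic_at0 Psi ->
  exists c : nat -> C, forall (u : C) k,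
    Opow k (fun t => Psi (u * t%:C%C) - (Psi (u * t%:C%C))^*%C -
                     (\poly_(i < k) (c i * u ^+ i - (c i * u ^+ i)^*%C)).[t%:C%C]).
Proof.
move=> /analytic_at0_trunc[c cPsi]; exists c => u k.
have [M [d d0 PsiM]] := cPsi k.
pose E t := Psi (u * t%:C%C) - \sum_(i < k) c i * (u * t%:C%C) ^+ i.
have EO : Opow k E.
  exists (M * normc u ^+ k).
  have u0 : 0 < normc u + 1 by rewrite ltr_pwDr ?normc_ge0.
  near=> t.
  have t0 : 0 < t by near: t; exact: nbhs_right_gt.
  have utE : normc (u * t%:C%C) = normc u * t by rewrite normcM normc_real gtr0_norm.
  have td : t < d / (normc u + 1) by near: t; apply: nbhs_right_lt; rewrite divr_gt0.
  rewrite ltr_pdivlMr// in td.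
  have /PsiM : normc (u * t%:C%C) < d by rewrite utE; lra.
  by rewrite utE exprMn mulrA.
apply: (eq_Opow _ (OpowB EO (Opow_conj EO))) => t; rewrite /E rmorphB rmorph_sum.
rewrite horner_poly.
have -> : \sum_(i < k) (c i * u ^+ i - (c i * u ^+ i)^*%C) * t%:C%C ^+ i =
    \sum_(i < k) c i * (u * t%:C%C) ^+ i - \sum_(i < k) ((c i * (u * t%:C%C) ^+ i)^*)%C.
  rewrite -sumrB; apply: eq_bigr => i _; rewrite exprMn mulrA mulrBl; congr (_ - _).
  by rewrite [in RHS]rmorphM; congr (_ * _); rewrite -rmorphXn [RHS]conjc_real.
by ring.
Unshelve. all: by end_near. Qed.

(* All branches of one Puiseux series have the same contact order: K is the
   least index such that the coefficient of x^(N K) in Psi is not real, as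
   unity_root N j ^+ (N * K) = 1 does not depend on j. *)
Lemma contact_order_unique N j j' Psi K K' : (0 < N)%N -> analytic_at0 Psi -> Psi 0 = 0 ->
  contact_order (branch N Psi j) K -> contact_order (branch N Psi j') K' -> (K' <= K)%N.
Proof.
move=> N0 Psia Psi0 /contact_order_Im cK /contact_order_Im cK'.
have {cK}[//|//|//|c c0 cK] := cK.
have {cK'}[//|//|//|c' c'0 cK'] := cK'.
have [a aO] := analytic_at0_conj_expansion Psia.
pose D u t := Psi (u * t%:C%C) - (Psi (u * t%:C%C))^*%C.
have real_coef u m : Opow m (D u) -> forall i, (i < m)%N -> a i * u ^+ i - (a i * u ^+
  i)^*%C = 0.
  move=> DO i im.
  have PO : Opow m (fun t => (\poly_(i < m) (a i * u ^+ i - (a i * u ^+ i)^*%C)).[t%:C%C]).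
    by apply: (eq_Opow _ (OpowB DO (aO u m))) => t; rewrite subKr.
  by have := Opow_poly_coef PO im; rewrite coef_poly im.
have DO_le u j1 K1 c1 : 0 < c1 -> u = unity_root R N j1 -> (\forall t \near 0^'+,
    c1 * t ^+ (N * K1) <= complex.Im (Psi (u * t%:C%C)) /\
    c1 * complex.Im (Psi (u * t%:C%C)) <= t ^+ (N * K1)) -> Opow (N * K1) (D u).
  move=> c10 _ h; exists (2 / c1); near=> t.
  have t0 : 0 < t by near: t; exact: nbhs_right_gt.
  have [h1 h2] : c1 * t ^+ (N * K1) <= complex.Im (Psi (u * t%:C%C)) /\
    c1 * complex.Im (Psi (u * t%:C%C)) <= t ^+ (N * K1) by near: t.
  rewrite normc_subcJ ger0_norm; last first.
    by rewrite (le_trans _ h1)// mulr_ge0 ?exprn_ge0// ltW.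
  by rewrite -mulrA ler_pM2l// [leRHS]mulrC ler_pdivlMr// [leLHS]mulrC.
rewrite leqNgt; apply/negP => KK'.
have uN i : unity_root R N i ^+ (N * K) = 1 by rewrite exprM unity_root_exp// expr1n.
(* Along the branch [j'] the imaginary part vanishes to order N K' > N K, so its coefficient of
   index N K is zero. As this coefficient is the same for all branches, the branch [j] would vanish
   to order N K + 1, against its lower bound. *)
have aNK : a (N * K)%N - (a (N * K)%N)^*%C = 0.
  have := real_coef _ _ (DO_le _ _ _ _ c'0 erefl cK') (N * K)%N.
  by rewrite uN mulr1; apply; rewrite ltn_pmul2l.
have : Opow (N * K).+1 (D (unity_root R N j)).
  apply: (eq_Opow _ (aO (unity_root R N j) (N * K).+1)) => t.
  rewrite (_ : \poly_(i < _) _ = 0) ?horner0 ?subr0//.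
  apply/polyP => i; rewrite coef_poly coef0 ltnS leq_eqVlt; case: ifP => // /orP[/eqP->|iK].
    by rewrite uN mulr1.
  exact: real_coef (DO_le _ _ _ _ c0 erefl cK) _ iK.
move=> [M DM].
have M0 : 0 < `|M| + 1 by rewrite ltr_pwDr.
near (0 : R)^'+ => t.
have t0 : 0 < t by near: t; exact: nbhs_right_gt.
have [h1 _] : c * t ^+ (N * K) <= complex.Im (Psi (unity_root R N j * t%:C%C)) /\
    c * complex.Im (Psi (unity_root R N j * t%:C%C)) <= t ^+ (N * K) by near: t.
have : normc (D (unity_root R N j) t) <= M * t ^+ (N * K).+1 by near: t.
have tc : t < c / (`|M| + 1) by near: t; apply: nbhs_right_lt; rewrite divr_gt0.
rewrite ltr_pdivlMr// in tc.
have tK0 : 0 < t ^+ (N * K) by rewrite exprn_gt0.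
apply/negP; rewrite -ltNge normc_subcJ exprS.
have := ler_norm (complex.Im (Psi (unity_root R N j * t%:C%C))).
have : t * (`|M| + 1) * t ^+ (N * K) < c * t ^+ (N * K) by rewrite ltr_pM2r.
have : M * (t * t ^+ (N * K)) <= `|M| * (t * t ^+ (N * K)).
  by rewrite ler_wpM2r ?ler_norm// mulr_ge0// ltW.
have : 0 <= t * t ^+ (N * K) by rewrite mulr_ge0// ltW.
have : 0 <= c * t ^+ (N * K) by rewrite mulr_ge0// ltW.
by lra.
Unshelve. all: by end_near. Qed.

End ContactUnique.

(** * Congruences modulo t^k *)

Section Congruence.
Variable R : realType.
Local Notation C := R[i].
Variable k : nat.
Implicit Types (f g : R -> C).

(** Boundedness is part of the relation so that it is compatible with products. *)
Definition eqO f g := [/\ Opow 0 f, Opow 0 g & Opow k (fun t => f t - g t)].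

Lemma eqO_refl f : Opow 0 f -> eqO f f.
Proof.
move=> fO; split=> //; apply: (@eq_Opow _ (fun=> 0)) => [t|]; first by rewrite subrr.
by exists 0; apply: nearW => t; rewrite normc0 mul0r.
Qed.

Lemma eq_eqO f g f' g' : f =1 f' -> g =1 g' -> eqO f g -> eqO f' g'.
Proof.
move=> ff' gg' [fO gO fgO]; split; [exact: eq_Opow fO|exact: eq_Opow gO|].
by apply: eq_Opow fgO => t; rewrite ff' gg'.
Qed.

Lemma eqO_cst z : eqO (fun=> z) (fun=> z).
Proof. exact/eqO_refl/Opow_cst. Qed.

Lemma eqOD f g f' g' : eqO f g -> eqO f' g' ->
  eqO (fun t => f t + f' t) (fun t => g t + g' t).
Proof.
move=> [fO gO h] [f'O g'O h']; split; [exact: OpowD|exact: OpowD|].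
by apply: (eq_Opow _ (OpowD h h')) => t; ring.
Qed.

Lemma eqON f g : eqO f g -> eqO (fun t => - f t) (fun t => - g t).
Proof.
move=> [fO gO h]; split; [exact: OpowN|exact: OpowN|].
by apply: (eq_Opow _ (OpowN h)) => t; ring.
Qed.

Lemma eqOM f g f' g' : eqO f g -> eqO f' g' ->
  eqO (fun t => f t * f' t) (fun t => g t * g' t).
Proof.
move=> [fO gO h] [f'O g'O h']; split; [exact: (OpowM fO f'O)|exact: (OpowM gO g'O)|].
have h1 := OpowM f'O h; have h2 := OpowM gO h'.
by apply: (eq_Opow _ (OpowD h1 h2)) => t; ring.
Qed.

Lemma eqO_sum (J : Type) (r : seq J) (F G : J -> R -> C) :
  (forall j, eqO (F j) (G j)) -> eqO (fun t => \sum_(j <- r) F j t) (fun t =>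
    \sum_(j <- r) G j t).
Proof.
move=> FG; elim: r => [|j r IHr].
  by apply: (eq_eqO _ _ (eqO_cst 0)) => t; rewrite big_nil.
by apply: (eq_eqO _ _ (eqOD (FG j) IHr)) => t; rewrite big_cons.
Qed.

Lemma eqO_prod (J : Type) (r : seq J) (F G : J -> R -> C) :
  (forall j, eqO (F j) (G j)) -> eqO (fun t => \prod_(j <- r) F j t) (fun t =>
    \prod_(j <- r) G j t).
Proof.
move=> FG; elim: r => [|j r IHr].
  by apply: (eq_eqO _ _ (eqO_cst 1)) => t; rewrite big_nil.
by apply: (eq_eqO _ _ (eqOM (FG j) IHr)) => t; rewrite big_cons.
Qed.

Definition eqO_poly (f g : R -> {poly C}) := forall i, eqO (fun t => (f t)`_i) (fun t =>
  (g t)`_i).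

Lemma eqO_polyM (f g f' g' : R -> {poly C}) : eqO_poly f g -> eqO_poly f' g' ->
  eqO_poly (fun t => f t * f' t) (fun t => g t * g' t).
Proof.
move=> fg fg' i.
apply: (@eq_eqO (fun t => \sum_(j < i.+1) (f t)`_j * (f' t)`_(i - j))
                (fun t => \sum_(j < i.+1) (g t)`_j * (g' t)`_(i - j))) => [t|t|].
- by rewrite coefM.
- by rewrite coefM.
- by apply: eqO_sum => j; exact: eqOM.
Qed.

Lemma eqO_poly_prod (J : Type) (r : seq J) (F G : J -> R -> {poly C}) :
  (forall j, eqO_poly (F j) (G j)) ->
  eqO_poly (fun t => \prod_(j <- r) F j t) (fun t => \prod_(j <- r) G j t).
Proof.
move=> FG; elim: r => [|j r IHr] i.
  by apply: (eq_eqO _ _ (eqO_cst (1 : {poly C})`_i)) => t; rewrite big_nil.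
by apply: (eq_eqO _ _ (eqO_polyM (FG j) IHr i)) => t; rewrite big_cons.
Qed.

Lemma eqO_horner n (f g : R -> {poly C}) (u : R -> C) :
  (forall t, (size (f t) <= n)%N) -> (forall t, (size (g t) <= n)%N) ->
  Opow 0 u -> eqO_poly f g -> eqO (fun t => (f t).[u t]) (fun t => (g t).[u t]).
Proof.
move=> fn gn uO fg.
apply: (@eq_eqO (fun t => \sum_(i < n) (f t)`_i * u t ^+ i)
                (fun t => \sum_(i < n) (g t)`_i * u t ^+ i)) => [t|t|].
- by rewrite (horner_coef_wide _ (fn t)).
- by rewrite (horner_coef_wide _ (gn t)).
apply: eqO_sum => i; apply: eqOM (fg i) _; apply: eqO_refl.
elim: (i : nat) => [|j IHj]; first exact: Opow_cst.
by apply: (eq_Opow _ (OpowM uO IHj)) => t; rewrite exprS.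
Qed.

Definition eqO_mx n (A B : R -> 'M[C]_n) := forall i j, eqO (fun t => A t i j) (fun t =>
  B t i j).

Lemma eqO_det n (A B : R -> 'M[C]_n) : eqO_mx A B ->
  eqO (fun t => \det (A t)) (fun t => \det (B t)).
Proof.
move=> AB.
apply: (@eqO_sum _ _ (fun (s : 'S_n) t => (-1) ^+ s * \prod_i A t i (s i))
                     (fun s t => (-1) ^+ s * \prod_i B t i (s i))) => s.
apply: (@eqOM (fun=> (-1) ^+ s) (fun=> (-1) ^+ s)); first exact: eqO_cst.
by apply: (@eqO_prod _ _ (fun i t => A t i (s i)) (fun i t => B t i (s i))) => i; exact: AB.
Qed.

Lemma eqO_companion n (f g : R -> {poly C}) : eqO_poly f g ->
  eqO_mx (fun t => companion n (f t)) (fun t => companion n (g t)).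
Proof.
move=> fg i j; apply: (@eq_eqO (fun t =>
  if i == n.-1 :> nat then - (f t)`_j else (i.+1 == j :> nat)%:R)
   (fun t => if i == n.-1 :> nat then - (g t)`_j else (i.+1 == j :> nat)%:R)) => [t|t|].
- by rewrite mxE.
- by rewrite mxE.
by case: (i == n.-1 :> nat); [exact: eqON|exact: eqO_cst].
Qed.

Lemma eqO_horner_mx n (A B : R -> 'M[C]_n.+1) (P : {poly {poly C}}) : eqO_mx A B ->
  eqO_mx (fun t => horner_mx (A t) (map_poly (horner_eval t%:C%C) P))
         (fun t => horner_mx (B t) (map_poly (horner_eval t%:C%C) P)).
Proof.
move=> AB; elim/poly_ind: P => [|P c IHP] i j.
  by apply: (eq_eqO _ _ (eqO_cst 0)) => t; rewrite !rmorph0 mxE.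
have XC (A' : R -> 'M[C]_n.+1) t :
    horner_mx (A' t) (map_poly (horner_eval t%:C%C) (P * 'X + c%:P)) i j =
    \sum_l horner_mx (A' t) (map_poly (horner_eval t%:C%C) P) i l * A' t l j +
    c.[t%:C%C] * (i == j)%:R.
  rewrite !(rmorphD, rmorphM)/= map_polyX map_polyC/= horner_mx_X horner_mx_C.
  by rewrite !mxE mulr_natr.
apply: (eq_eqO _ _ (eqOD (eqO_sum _ (fun l => eqOM (IHP i l) (AB l j)))
                         (eqOM (eqO_refl (Opow_horner c)) (eqO_cst (i == j)%:R)))) => t.
- by rewrite XC.
- by rewrite XC.
Qed.

End Congruence.

(** * Low-degree coefficients in two variables, read along lines *)

Section Bivariate.
Variable R : realType.
Local Notation C := R[i].

Lemma Opow_all_zero (p : {poly C}) : (forall z, p.[z] = 0) -> p = 0.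
Proof.
move=> p0; apply/polyP => i; rewrite coef0.
apply: (@Opow_poly_coef R p i.+1) => //.
by exists 0; apply: nearW => t; rewrite p0 normc0 mul0r.
Qed.

(** On the line (s t, t) the coefficient of t^d is the polynomial [H] in s, whose coefficients are
    those of [E] of total degree d; it vanishes for every s. *)
Lemma Opow_bivariate_coef (E : {poly {poly C}}) k :
  (forall s : C, Opow k (fun t => E.[s * t%:C%C, t%:C%C])) ->
  forall i j, (i + j < k)%N -> E`_i`_j = 0.
Proof.
move=> EO i j ijk; pose d := (i + j)%N.
pose H := \poly_(l < size E) (if (d < l)%N then 0 else E`_l`_(d - l)).
have GE s t : (E.[s%:P * 'X]).[t] = E.[s * t, t].
  have evE q : (E.[q]).[t] = (map_poly (horner_eval t) E).[q.[t]].
    exact/esym/(horner_map (horner_eval t)).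
  by rewrite !evE hornerM !hornerC hornerX.
have Gd s : (E.[s%:P * 'X])`_d = H.[s].
  rewrite horner_coef coef_sum horner_poly; apply: eq_bigr => l _.
  rewrite exprMn -polyC_exp mulrA mulrC coefXnM; case: ifP => // _; first by rewrite mul0r.
  by rewrite mulrC coefCM mulrC.
have H0 : H = 0.
  apply: Opow_all_zero => s; rewrite -Gd; apply: (@Opow_poly_coef R _ k) => //.
  by apply: (eq_Opow _ (EO s)) => t; rewrite GE.
have /(congr1 (fun p : {poly C} => p`_i)) := H0.
have di : (d < i)%N = false by rewrite ltnNge leq_addr.
rewrite coef_poly coef0 di /d addKn.
by case: ltnP => // Ei _; rewrite (nth_default _ Ei) coef0.
Qed.

End Bivariate.

(** * Roots of Weierstrass polynomials *)

Section MonicPoly.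
Variables (S : nzRingType) (N : nat) (a : 'I_N -> S).

Definition monic_of : {poly S} := 'X^N + \sum_(j < N) a j *: 'X^j.

Lemma size_monic_of_tail : (size (\sum_(j < N) a j *: 'X^j)%R < size ('X^N : {poly S}))%N.
Proof.
rewrite size_polyXn ltnS (leq_trans (size_sum _ _ _))//.
by apply/bigmax_leqP => j _; rewrite (leq_trans (size_scale_leq _ _))// size_polyXn.
Qed.

Lemma size_monic_of : size monic_of = N.+1.
Proof. by rewrite size_polyDl ?size_monic_of_tail// size_polyXn. Qed.

Lemma monic_of_monic : monic_of \is monic.
Proof. by rewrite monicE lead_coefDl ?size_monic_of_tail// lead_coefXn. Qed.

End MonicPoly.

Lemma map_monic_of (S S' : nzRingType) (h : {rmorphism S -> S'}) N (a : 'I_N -> S) :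
  map_poly h (monic_of a) = monic_of (h \o a).
Proof.
rewrite rmorphD /= map_polyXn rmorph_sum; congr (_ + _); apply: eq_bigr => j _.
by rewrite /= map_polyZ map_polyXn.
Qed.

Section WeierstrassRoots.
Variable R : realType.
Local Notation C := R[i].

Lemma near0_right (P : R -> Prop) : (\forall t \near 0^'+, P t) ->
  exists2 r : R, 0 < r & forall t, 0 < t -> t < r -> P t.
Proof.
move=> /nbhs_ballP[r /= r0 rP]; exists r => // t t0 tr.
by apply: rP => //; rewrite -ball_normE /ball_/= sub0r normrN gtr0_norm.
Qed.

Lemma near0_uniform n (P : 'I_n -> R -> R -> Prop) :
  (forall k c c' t, c' <= c -> P k c t -> P k c' t) ->
  (forall k, exists2 c, 0 < c & \forall t \near 0^'+, P k c t) ->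
  exists2 c, 0 < c & \forall t \near 0^'+, forall k, P k c t.
Proof.
move=> Pmono; elim: n P Pmono => [|n IHn] P Pmono cP.
  by exists 1 => //; apply: nearW => t [].
have [c c0 Pc] := cP ord0.
have [|k|c' c'0 Pc'] := IHn (fun k => P (lift ord0 k)).
- by move=> k; exact: Pmono.
- exact: cP.
exists (Num.min c c'); first by rewrite lt_min c0.
apply: filterS2 Pc Pc' => t Pct Pc't k.
have [->|[k' ->]] : k = ord0 \/ exists k', k = lift ord0 k'.
  by case: (unliftP ord0 k) => [k' ->|->]; [right; exists k'|left].
  by apply: Pmono Pct; rewrite ge_min lexx.
by apply: Pmono (Pc't k'); rewrite ge_min lexx orbT.
Qed.

Lemma horner_monic_of N (a : 'I_N -> C) w :
  (monic_of a).[w] = w ^+ N + \sum_(j < N) a j * w ^+ j.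
Proof.
rewrite hornerD hornerXn horner_sum; congr (_ + _); apply: eq_bigr => j _.
by rewrite hornerZ hornerXn.
Qed.

Lemma weierstrass_roots_small N (a : 'I_N -> C -> C) e :
  (forall j, analytic_at0 (a j) /\ a j 0 = 0) -> 0 < e ->
  \forall t \near 0^'+, forall w, (monic_of (a^~ t%:C%C)).[w] = 0 -> normc w <= e.
Proof.
move=> aan; wlog e1 : e / e <= 1.
  move=> H e0; have [e1|/ltW e1] := leP e 1; first exact: H.
  by apply: filterS (H 1 (lexx _) ltr01) => t h w /h w1; rewrite (le_trans w1).
(* If |w| > e, with e <= 1 and all coefficients at most eta, each lower term is at most |w|^N / (N +
   1), and N such terms cannot balance w^N. *)
move=> e0; pose eta := e ^+ N / N.+1%:R.
have eta0 : 0 < eta by rewrite divr_gt0// ?exprn_gt0// ltr0n.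
have [_ _ aeta] : exists2 c : R, 0 < c & \forall t \near 0^'+, forall j, normc (a j
  t%:C%C) <= eta.
  apply: (@near0_uniform N (fun j _ t => normc (a j t%:C%C) <= eta)) => // j.
  exists 1 => //; have [aj aj0] := aan j.
  by apply: filterS (analytic_at0_small 1 aj aj0 eta0) => t; rewrite mul1r.
apply: filterS aeta => t aeta w; rewrite horner_monic_of => /eqP.
rewrite addrC addr_eq0 => /eqP/(congr1 (@normc R)); rewrite normcN normcX => wN.
rewrite leNgt; apply/negP => ew.
have w0 : 0 < normc w := lt_trans e0 ew.
have : normc w ^+ N <= \sum_(j < N) normc w ^+ N / N.+1%:R.
  rewrite -{1}wN (le_trans (le_normc_sum _ _ _))//; apply: ler_sum => j _.
  rewrite normcM normcX (@le_trans _ _ (eta * normc w ^+ j))//.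
    by rewrite ler_wpM2r// exprn_ge0// ltW.
  rewrite /eta mulrAC ler_wpM2r ?invr_ge0//.
  have jN : (j <= N)%N by exact: ltnW.
  rewrite -[in leRHS](subnK jN) exprD ler_wpM2r ?exprn_ge0 ?(ltW w0)//.
  apply: (@le_trans _ _ (e ^+ (N - j))).
    by rewrite ler_wiXn2l ?(ltW e0)// leq_subr.
  by rewrite lerXn2r ?nnegrE ?ltW.
rewrite sumr_const card_ord -(mulr_natr (_ / _)) -mulrA [X in _ * X]mulrC.
apply/negP; rewrite -ltNge -[ltRHS]mulr1 ltr_pM2l ?exprn_gt0//.
by rewrite ltr_pdivrMr ?ltr0n// mul1r ltr_nat.
Qed.

(** The roots over w2 = t are small enough for the Puiseux parametrization to apply. Each is Psi(s)
    with s^N = t, so s is a root of unity times the real root l of t, and l^(N K) = t^K. *)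
Lemma weierstrass_roots_Im N (a : 'I_N -> C -> C) (f : C -> C -> C) Psi K :
  (forall j, analytic_at0 (a j) /\ a j 0 = 0) ->
  (\forall w \near ((0, 0) : C^o * C^o),
      f w.1 w.2 = w.1 ^+ N + \sum_(j < N) a j w.2 * w.1 ^+ j) ->
  puiseux_parametrization f N Psi ->
  (forall j, (j < N)%N -> contact_order (branch N Psi j) K) ->
  exists2 c : R, 0 < c & \forall t \near 0^'+,
    forall w, (monic_of (a^~ t%:C%C)).[w] = 0 -> c * t ^+ K <= complex.Im w.
Proof.
move=> aan /near00C_ball[d d0 fE] [Psia Psi0 /near00C_ball[d' d'0 fP]] cK.
have [N0|N0] := posnP N.
  exists 1 => //; apply: nearW => t w; rewrite horner_monic_of.
  by move: a {aan fE}; rewrite N0 => a; rewrite big_ord0 addr0 expr0 => /eqP;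
    rewrite oner_eq0.
have [|j|c c0 cIm] := @near0_uniform N (fun j c l => 0 < l ->
    c * l ^+ (N * K) <= complex.Im (Psi (unity_root R N j * l%:C%C))).
- by move=> j c c' l cc' h l0; rewrite (le_trans _ (h l0))// ler_wpM2r// exprn_ge0// ltW.
- have [c c0 h] := contact_order_Im N0 Psia Psi0 (cK j (ltn_ord j)).
  by exists c => //; apply: filterS h => l [].
exists c => //.
have [r r0 rIm] := near0_right cIm.
have dd0 : 0 < Num.min d d' / 2 by rewrite divr_gt0// lt_min d0.
near=> t => w w0.
have t0 : 0 < t by near: t; exact: nbhs_right_gt.
have [l l0 lt] := exists_root N0 t0.
have lr : l < r.
  have tr : t < r ^+ N by near: t; apply: nbhs_right_lt; rewrite exprn_gt0.
  rewrite ltNge; apply/negP => rl; move: tr; apply/negP; rewrite -leNgt -lt.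
  by apply: lerXn2r; rewrite ?nnegrE ?(ltW r0) ?(ltW l0).
have wd : normc w <= Num.min d d' / 2.
  by move: w w0; near: t; exact: weierstrass_roots_small.
have td : t < Num.min d d' / 2 by near: t; apply: nbhs_right_lt.
have mind : Num.min d d' <= d by rewrite ge_min lexx.
have mind' : Num.min d d' <= d' by rewrite ge_min lexx orbT.
have nt : normc t%:C%C = t by rewrite normc_real gtr0_norm.
have fwt : f w t%:C%C = 0.
  by rewrite (fE w t%:C%C) ?nt -?horner_monic_of//=; lra.
have wd' : normc w < d' by lra.
have td' : normc t%:C%C < d' by rewrite nt; lra.
have [s [/= sN ->]] := (fP _ _ wd' td').1 fwt.
have [j jN ->] : exists2 j, (j < N)%N & s = unity_root R N j * l%:C%C.
  by apply: eq_exp_unity_root => //; rewrite sN -rmorphXn lt.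
have := rIm l l0 lr (Ordinal jN) l0.
by rewrite exprM lt.
Unshelve. all: by end_near. Qed.

End WeierstrassRoots.

(** * Lower bound for the resultant *)

Section LowerBound.
Variable R : realType.
Local Notation C := R[i].

Lemma normc_ge_Im (z : C) : `|complex.Im z| <= normc z.
Proof.
case: z => a b /=; rewrite -sqrtr_sqr ler_wsqrtr// lerDr sqr_ge0//.
Qed.

Lemma ler_prod_seq (rs : seq C) (F : C -> R) b : 0 <= b ->
  (forall r, r \in rs -> b <= F r) -> b ^+ size rs <= \prod_(r <- rs) F r.
Proof.
move=> b0; elim: rs => [|r rs IHrs] h; first by rewrite big_nil.
rewrite big_cons exprS ler_pM ?exprn_ge0 ?h ?mem_head//.
by apply: IHrs => r' r'rs; rewrite h// inE r'rs orbT.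
Qed.

(** For real t the modulus of [P] at a root r is that of [Q] at conj r. There the factorization of
    [Q] gives a unit, at least half its value at the origin in modulus, times all the differences
    conj r - r'. *)
Lemma resultant_lower_bound L (N kappa : 'I_L -> nat) (a : forall k, 'I_(N k) -> C -> C)
    (P Q : {poly {poly C}}) (alpha : C -> C -> C) (c : R) :
  (forall w1 w2, normc P.[w1, w2] = normc Q.[(w1^*)%C, (w2^*)%C]) ->
  analytic_at00 alpha -> alpha 0 0 != 0 ->
  (\forall w \near ((0, 0) : C^o * C^o),
     Q.[w.1, w.2] = alpha w.1 w.2 * \prod_k (monic_of ((@a k)^~ w.2)).[w.1]) ->
  (forall k j, analytic_at0 (@a k j) /\ @a k j 0 = 0) ->
  0 < c ->
  (\forall t \near 0^'+, forall k w, (monic_of ((@a k)^~ t%:C%C)).[w] = 0 ->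
     c * t ^+ kappa k <= complex.Im w) ->
  exists2 C0 : R, 0 < C0 & \forall t \near 0^'+, forall rs : 'I_L -> seq C,
    (forall k, monic_of ((@a k)^~ t%:C%C) = \prod_(r <- rs k) ('X - r%:P)) ->
    C0 * t ^+ (\sum_k \sum_k' (N k * N k' * minn (kappa k) (kappa k'))) <=
    normc (\prod_k \prod_(r <- rs k) P.[r, t%:C%C]).
Proof.
move=> PQ /analytic_at00_trunc[ac /(_ 1%N)[M [d d0 alphaM]]] alpha0 /near00C_ball[d' d'0
  QE] aan c0 aIm.
have ac0 : ac 0 0%N = alpha 0 0.
  have := alphaM 0 0 0; rewrite normc0 lexx d0 => /(_ erefl erefl erefl).
  rewrite !big_ord1 !expr0 !mulr1 mulr0 => h; apply/esym/eqP; rewrite -subr_eq0;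
    apply/eqP/eq0_normc.
  by apply/eqP; rewrite eq_le h normc_ge0.
pose a0 := normc (alpha 0 0) / 2.
have a00 : 0 < a0.
  rewrite divr_gt0// lt_neqAle normc_ge0 andbT eq_sym; apply: contraNneq alpha0.
  by move=> /eq0_normc ->.
exists (\prod_k (a0 * \prod_k' c ^+ N k') ^+ N k).
  apply: prodr_gt0 => k _; rewrite exprn_gt0// mulr_gt0//.
  by apply: prodr_gt0 => k' _; rewrite exprn_gt0.
(* Within [e] both the factorization of [Q] and the estimate of alpha hold, and M e < a0 keeps
   |alpha| above [a0]. *)
pose e := Num.min (Num.min d d') (a0 / (`|M| + 1)) / 2.
have M1 : 0 < `|M| + 1 by rewrite ltr_pwDr.
have e0 : 0 < e by rewrite divr_gt0// !lt_min d0 d'0 divr_gt0.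
have [ed [ed' ea]] : e < d /\ e < d' /\ e * (`|M| + 1) < a0.
  have h : e * 2 = Num.min (Num.min d d') (a0 / (`|M| + 1)) by rewrite divfK.
  have : e * 2 <= d by rewrite h !ge_min lexx.
  have : e * 2 <= d' by rewrite h !ge_min lexx orbT.
  have : e * 2 <= a0 / (`|M| + 1) by rewrite h ge_min lexx orbT.
  rewrite ler_pdivlMr// => h1 h2 h3; split; first lra.
  split; first lra.
  have : 0 < e * (`|M| + 1) by rewrite mulr_gt0.
  by lra.
near=> t => rs rsE.
have t0 : 0 < t by near: t; exact: nbhs_right_gt.
have t1 : t < 1 by near: t; exact: nbhs_right_lt.
have te : t < e by near: t; exact: nbhs_right_lt.
have nt : normc t%:C%C = t by rewrite normc_real gtr0_norm.
have tIm k w : (monic_of ((@a k)^~ t%:C%C)).[w] = 0 -> c * t ^+ kappa k <= complex.Im w.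
  by move: k w; near: t.
have small k w : (monic_of ((@a k)^~ t%:C%C)).[w] = 0 -> normc w <= e.
  move: k w; near: t; apply: filter_forall => k.
  exact: weierstrass_roots_small.
have rs_root k r : r \in rs k -> (monic_of ((@a k)^~ t%:C%C)).[r] = 0.
  by move=> rk; apply/rootP; rewrite rsE root_prod_XsubC.
have rs_size k : size (rs k) = N k.
  by have := size_monic_of ((@a k)^~ t%:C%C); rewrite rsE size_prod_XsubC => -[].
have Pr k r : r \in rs k ->
    a0 * \prod_k' (c * t ^+ minn (kappa k) (kappa k')) ^+ N k' <= normc P.[r, t%:C%C].
  move=> rk; have re := small _ _ (rs_root _ _ rk).
  have rIm := tIm _ _ (rs_root _ _ rk).
  rewrite PQ conjc_real.
  have re' : normc (r^*)%C < d' by rewrite normc_conj (le_lt_trans re).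
  have te' : normc t%:C%C < d' by rewrite nt (lt_trans te).
  rewrite (QE _ _ re' te')/= normcM normc_prod.
  rewrite ler_pM ?(ltW a00)//.
  - by apply: prodr_ge0 => k' _; rewrite exprn_ge0// mulr_ge0 ?(ltW c0)// exprn_ge0// ltW.
  - have := alphaM (r^*)%C t%:C%C e; rewrite normc_conj nt.
    move=> /(_ re (ltW te) ed); rewrite !big_ord1 !expr0 !mulr1 ac0 expr1.
    have := le_normcB (alpha 0 0) (alpha 0 0 - alpha (r^*)%C t%:C%C).
    rewrite subKr -(normcN (alpha 0 0 - _)) opprB.
    have : M * e <= `|M| * e by rewrite ler_wpM2r ?ler_norm// ltW.
    by rewrite /a0 in ea *; lra.
  apply: ler_prod => k' _; apply/andP; split.
    by rewrite exprn_ge0// mulr_ge0 ?(ltW c0)// exprn_ge0// ltW.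
  rewrite rsE horner_prod normc_prod -(rs_size k').
  apply: ler_prod_seq => [|r' r'k]; first by rewrite mulr_ge0 ?(ltW c0)// exprn_ge0// ltW.
  have r'Im := tIm _ _ (rs_root _ _ r'k).
  rewrite hornerXsubC (le_trans _ (normc_ge_Im _))// -normrN.
  have -> : - complex.Im ((r^*)%C - r') = complex.Im r + complex.Im r'.
    by case: (r) (r') => [a1 b1] [a2 b2] /=; ring.
  rewrite (le_trans _ (ler_norm _))//.
  have tk0 l : 0 <= c * t ^+ l by rewrite mulr_ge0 ?(ltW c0)// exprn_ge0// ltW.
  have [h|h] := leqP (kappa k) (kappa k').
    by have := tk0 (kappa k'); lra.
  by have := tk0 (kappa k); lra.
rewrite normc_prod.
have -> : \prod_k (a0 * \prod_k' c ^+ N k') ^+ N k *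
    t ^+ (\sum_k \sum_k' N k * N k' * minn (kappa k) (kappa k')) =
    \prod_k (a0 * \prod_k' (c * t ^+ minn (kappa k) (kappa k')) ^+ N k') ^+ N k.
  rewrite (big_morph (fun e => t ^+ e) (exprD t) (expr0 t)) -big_split/=.
  apply: eq_bigr => k _.
  rewrite (big_morph (fun e => t ^+ e) (exprD t) (expr0 t)).
  under [in RHS]eq_bigr do rewrite exprMn.
  rewrite big_split/= mulrA [in RHS]exprMn; congr (_ * _).
  rewrite -prodrXl; apply: eq_bigr => k' _.
  by rewrite -!exprM; congr (_ ^+ _); rewrite mulnC [(N k * _)%N]mulnC.
apply: ler_prod => k _; apply/andP; split.
  rewrite exprn_ge0// mulr_ge0 ?(ltW a00)// prodr_ge0// => k' _.
  by rewrite exprn_ge0// mulr_ge0 ?(ltW c0)// exprn_ge0// ltW.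
rewrite normc_prod -{1}(rs_size k); apply: ler_prod_seq; last by move=> r; exact: Pr.
rewrite mulr_ge0 ?(ltW a00)// prodr_ge0// => k' _.
by rewrite exprn_ge0// mulr_ge0 ?(ltW c0)// exprn_ge0// ltW.
Unshelve. all: by end_near. Qed.
End LowerBound.

(** * Reflection in the half-plane coordinates *)

Section Reflection.
Variable R : realType.
Local Notation C := R[i].
Implicit Types p : {poly {poly C}}.

(** Reversing the indices exchanges the powers of 1 + iu and 1 - iu, and conjugation at the
    conjugate point exchanges them too. Reflection in the circle thus becomes conjugation of
    coefficients. *)
Lemma mobius_reflection m n p (u v : C) :
  (mobius 'i m n (reflection m n p)).[u, v] = ((mobius 'i m n p).[u^*, v^*])^*.
Proof.
rewrite !horner_mobius rmorph_sum (reindex_inj rev_ord_inj); apply: eq_bigr => i _.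
rewrite rmorph_sum (reindex_inj rev_ord_inj); apply: eq_bigr => j _.
rewrite !(rmorphM, rmorphXn, rmorphD, rmorphN, rmorph1)/= !conjCK conjCi !mulNr !opprK.
rewrite /reflection !coef_poly !subSS !ltnS !leq_subr coef_poly ltnS leq_subr.
rewrite !subKn -1?ltnS//; congr (_ * _ * _); exact: mulrC.
Qed.

Lemma size_reflection m n p : (size (reflection m n p) <= m.+1)%N.
Proof. exact: size_poly. Qed.

Lemma sizeY_reflection m n p : (sizeY (reflection m n p) <= n.+1)%N.
Proof.
by apply/bigmax_leqP => i _; rewrite coef_poly; case: ifP => _;
  rewrite ?size_poly0// size_poly.
Qed.

Lemma normc_mobius_reflection m n p (u v : C) :
  normc (mobius 'i m n p).[u, v] =
  normc (mobius 'i m n (reflection m n p)).[(u^*)%C, (v^*)%C].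
Proof. by rewrite mobius_reflection [in RHS]normc_conj !conjCK. Qed.

End Reflection.

Lemma prod_monic_size (S : comNzRingType) L (N : 'I_L -> nat) (F : 'I_L -> {poly S}) :
  (forall k, F k \is monic) -> (forall k, size (F k) = (N k).+1) ->
  (\prod_k F k \is monic) * (size (\prod_k F k) = (\sum_k N k).+1).
Proof.
move=> Fm FN.
have H (r : seq 'I_L) : \prod_(k <- r) F k \is monic /\
    size (\prod_(k <- r) F k) = (\sum_(k <- r) N k).+1.
  elim: r => [|k r [IHm IHs]]; first by rewrite !big_nil monic1 size_poly1.
  by rewrite !big_cons monicMl// size_monicM ?monic_neq0// FN IHs addSn addnS.
by have [] := H (index_enum _).
Qed.

Lemma hornerXY_map (S : comNzRingType) (p : {poly {poly S}}) x y :
  p.[x, y] = (map_poly (horner_eval y) p).[x].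
Proof.
rewrite -[x in RHS](hornerC x y); exact/esym/(horner_map (horner_eval y)).
Qed.

Lemma det_horner_companion (F : closedFieldType) n (W P : {poly F}) (J : finType)
    (rs : J -> seq F) : W \is monic -> size W = n.+2 ->
  W = \prod_j \prod_(r <- rs j) ('X - r%:P) ->
  \det (horner_mx (companion n.+1 W) P) = \prod_j \prod_(r <- rs j) P.[r].
Proof.
move=> Wm Wn WE.
rewrite (@det_horner_mx _ _ _ _ (flatten [seq rs j | j <- index_enum J])).
  by rewrite big_flatten big_map.
by rewrite char_poly_companion// {1}WE big_flatten big_map.
Qed.

Lemma map_companion (S S' : nzRingType) (h : {rmorphism S -> S'}) n (W : {poly S}) :
  map_mx h (companion n W) = companion n (map_poly h W).
Proof.
apply/matrixP => i j; rewrite !mxE coef_map.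
by case: ifP => _; rewrite ?rmorphN ?rmorph_nat.
Qed.

Section Assembly.
Variable R : realType.
Local Notation C := R[i].

Lemma near00_small (e : R) : 0 < e ->
  \forall w \near ((0, 0) : C^o * C^o), normc w.1 <= e /\ normc w.2 <= e.
Proof.
move=> e0; apply/nbhs_ballP; exists e%:C%C; first by rewrite /= ltcR.
move=> [z w] []; rewrite /= -!ball_normE /ball_/= !sub0r !normrN !normCE !ltcR.
by move=> /ltW ? /ltW.
Qed.

Lemma Opow_trunc (f : C -> C) (c : nat -> C) k :
  (exists M : R, exists2 d : R, 0 < d & forall z, normc z < d ->
      normc (f z - \sum_(i < k) c i * z ^+ i) <= M * normc z ^+ k) ->
  eqO k (fun t => f t%:C%C) (fun t => (\poly_(i < k) c i).[t%:C%C]).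
Proof.
move=> [M [d d0 fM]].
have h : Opow k (fun t => f t%:C%C - (\poly_(i < k) c i).[t%:C%C]).
  exists M; near=> t.
  have t0 : 0 < t by near: t; exact: nbhs_right_gt.
  have td : t < d by near: t; exact: nbhs_right_lt.
  have := fM t%:C%C; rewrite normc_real gtr0_norm// => /(_ td).
  by rewrite horner_poly.
split=> //; last exact: Opow_horner.
by apply: (eq_Opow _ (OpowD (leq_Opow (leq0n k) h) (Opow_horner (\poly_(i < k) c i)))) =>
  t; rewrite subrK.
Unshelve. all: by end_near. Qed.

Lemma eqO_monic_of k N (f g : 'I_N -> R -> C) : (forall j, eqO k (f j) (g j)) ->
  eqO_poly k (fun t => monic_of (f^~ t)) (fun t => monic_of (g^~ t)).
Proof.
move=> fg i.
have E (h : 'I_N -> R -> C) t :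
    (monic_of (h^~ t))`_i = ('X^N)`_i + \sum_(j < N) h j t * ('X^j)`_i.
  by rewrite coefD coef_sum; congr (_ + _); apply: eq_bigr => j _; rewrite coefZ.
apply: (eq_eqO (fun t => esym (E f t)) (fun t => esym (E g t))).
apply: eqOD; first exact: eqO_cst.
by apply: eqO_sum => j; apply: eqOM => //; exact: eqO_cst.
Qed.

Lemma sum_tagged L0 L (N : 'I_L -> nat) (s : 'I_L0 -> {k : 'I_L & 'I_(N k)})
    (F : 'I_L -> nat) : bijective s ->
  (\sum_(l < L0) F (tag (s l)) = \sum_(k < L) N k * F k)%N.
Proof.
move=> sbij; rewrite -(reindex s (P := xpredT) (F := fun u => F (tag u)))/=;
  last exact: onW_bij.
rewrite -(sig_big_dep xpredT (fun _ => xpredT) (fun k _ => F k))/=.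
by apply: eq_bigr => k _; rewrite sum_nat_const card_ord.
Qed.

Lemma Opow_low_coef (p : {poly C}) k : (forall i, (i < k)%N -> p`_i = 0) ->
  Opow k (fun t => p.[t%:C%C]).
Proof.
move=> p0; apply: (@eq_Opow _ (fun t => \sum_(i < size p) p`_i * t%:C%C ^+ i)) => [t|].
  by rewrite horner_coef.
apply: Opow_sum => i; have [/p0->|ki] := ltnP i k.
  by apply: (@eq_Opow _ (fun=> 0)) => [t|]; [rewrite mul0r|exists 0; apply: nearW => t;
    rewrite normc0 mul0r].
exact: (OpowM (Opow_cst p`_i) (leq_Opow ki (@Opow_exp R i))).
Qed.

Lemma Opow_lower_bound (f : R -> C) c k : 0 < c ->
  (\forall t \near 0^'+, c * t ^+ k <= normc (f t)) -> ~ Opow k.+1 f.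
Proof.
move=> c0 cf [M fM].
have M1 : 0 < `|M| + 1 by rewrite ltr_pwDr.
near (0 : R)^'+ => t.
have t0 : 0 < t by near: t; exact: nbhs_right_gt.
have tc : t < c / (`|M| + 1) by near: t; apply: nbhs_right_lt; rewrite divr_gt0.
rewrite ltr_pdivlMr// in tc.
have h1 : c * t ^+ k <= normc (f t) by near: t.
have h2 : normc (f t) <= M * t ^+ k.+1 by near: t.
have := le_trans h1 h2; rewrite exprS mulrA ler_pM2r ?exprn_gt0//.
apply/negP; rewrite -ltNge (le_lt_trans _ tc)// mulrC ler_wpM2l ?(ltW t0)//.
by rewrite (le_trans (ler_norm _))// lerDl.
Unshelve. all: by end_near. Qed.

End Assembly.

(** * Proof of the bound *)

Section Germs.
Variable R : realType.
Local Notation C := R[i].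

(** Truncating alpha and the coefficients of the factors changes the product by O(t^k) on every line
    (s t, t), which determines the coefficients of total degree below [k]. The third conclusion
    serves the ideal, the fourth the determinant. *)
Lemma germ_factorization_trunc L (N : 'I_L -> nat) (a : forall k, 'I_(N k) -> C -> C)
    (Q : {poly {poly C}}) (alpha : C -> C -> C) k :
  analytic_at00 alpha ->
  (\forall w \near ((0, 0) : C^o * C^o),
     Q.[w.1, w.2] = alpha w.1 w.2 * \prod_k (monic_of ((@a k)^~ w.2)).[w.1]) ->
  (forall k j, analytic_at0 (@a k j)) -> (0 < k)%N ->
  exists (al W : {poly {poly C}}),
    [/\ al.[0, 0] = alpha 0 0, (W \is monic) && (size W == (\sum_k N k).+1),
      forall i j, (i + j < k)%N -> (Q - al * W)`_i`_j = 0 &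
      eqO_poly k (fun t => \prod_k monic_of ((@a k)^~ t%:C%C))
        (fun t => map_poly (horner_eval t%:C%C) W)].
Proof.
move=> alan QE aan k0.
pose c l j := sval (cid (analytic_at0_trunc (aan l j))).
have cP l j := svalP (cid (analytic_at0_trunc (aan l j))).
pose tr l j := \poly_(i < k) c l j i.
pose W := \prod_l monic_of (tr l).
have [Wm Ws] := prod_monic_size (fun l => monic_of_monic (tr l)) (fun l =>
  size_monic_of (tr l)).
have WE t : map_poly (horner_eval t) W = \prod_l monic_of (fun j => (tr l j).[t]).
  by rewrite rmorph_prod; apply: eq_bigr => l _; exact: (map_monic_of (horner_eval t)).
have aW : eqO_poly k (fun t => \prod_k monic_of ((@a k)^~ t%:C%C))
        (fun t => map_poly (horner_eval t%:C%C) W).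
  move=> i; apply: (@eq_eqO _ k (fun t => (\prod_k monic_of ((@a k)^~ t%:C%C))`_i)
    (fun t => (\prod_l monic_of (fun j => (tr l j).[t%:C%C]))`_i)) => // [t|].
    by rewrite WE.
  apply: (@eqO_poly_prod _ _ _ _ (fun l t => monic_of ((@a l)^~ t%:C%C))
    (fun l t => monic_of (fun j => (tr l j).[t%:C%C]))) => l.
  apply: (@eqO_monic_of _ _ _ (fun j t => a l j t%:C%C) (fun j t =>
    (tr l j).[t%:C%C])) => j.
  exact: Opow_trunc (cP l j k).
have [b /(_ k)[M [d d0 bM]]] := analytic_at00_trunc alan.
pose al : {poly {poly C}} := \poly_(i < k) \poly_(j < k) b i j.
have alE z w : al.[z, w] = \sum_(i < k) \sum_(j < k) b i j * z ^+ i * w ^+ j.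
  rewrite horner_poly horner_sum; apply: eq_bigr => i _.
  rewrite hornerM horner_poly horner_exp hornerC mulr_suml; apply: eq_bigr => j _.
  by rewrite mulrAC.
exists al, W; split=> //; [|by rewrite Wm Ws eqxx|].
  have := bM 0 0 0; rewrite normc0 lexx d0 -alE expr0n eqn0Ngt k0 mulr0.
  move=> /(_ erefl erefl erefl) h; apply/esym/eqP; rewrite -subr_eq0; apply/eqP/eq0_normc.
  by apply/eqP; rewrite eq_le h normc_ge0.
apply: Opow_bivariate_coef => s.
have [d' d'0 QE'] := near00C_ball QE.
have s1 : 0 < normc s + 1 by rewrite ltr_pwDr ?normc_ge0.
have st (t : R) : 0 < t -> normc (s * t%:C%C) <= (normc s + 1) * t.
  by move=> t0; rewrite normcM normc_real gtr0_norm// ler_pM2r// lerDl.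
have tt (t : R) : 0 < t -> normc t%:C%C <= (normc s + 1) * t.
  by move=> t0; rewrite normc_real gtr0_norm// ler_peMl ?(ltW t0)// lerDr normc_ge0.
have alO : eqO k (fun t => alpha (s * t%:C%C) t%:C%C) (fun t => al.[s * t%:C%C, t%:C%C]).
  have h : Opow k (fun t => alpha (s * t%:C%C) t%:C%C - al.[s * t%:C%C, t%:C%C]).
    exists (M * (normc s + 1) ^+ k); near=> t.
    have t0 : 0 < t by near: t; exact: nbhs_right_gt.
    have td : t < d / (normc s + 1) by near: t; apply: nbhs_right_lt; rewrite divr_gt0.
    rewrite ltr_pdivlMr// mulrC in td.
    by rewrite alE -mulrA -exprMn; apply: bM => //; [exact: st|exact: tt].
  have alb : Opow 0 (fun t => al.[s * t%:C%C, t%:C%C]).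
    apply: (@eq_Opow _ (fun t => (al.[s%:P * 'X]).[t%:C%C])); last exact: Opow_horner.
    by move=> t; rewrite [RHS]hornerXY_map -horner_evalE -horner_map/= /horner_eval
      hornerM hornerC hornerX.
  split=> //; apply: (eq_Opow _ (OpowD (leq_Opow (leq0n k) h) alb)) => t.
  by rewrite subrK.
have WO : eqO k (fun t => (\prod_k monic_of ((@a k)^~ t%:C%C)).[s * t%:C%C])
                (fun t => W.[s * t%:C%C, t%:C%C]).
  apply: (@eq_eqO _ k (fun t => (\prod_k monic_of ((@a k)^~ t%:C%C)).[s * t%:C%C])
     (fun t => (map_poly (horner_eval t%:C%C) W).[s * t%:C%C])) => // [t|].
    by rewrite hornerXY_map.
  apply: (@eqO_horner _ _ (\sum_k N k).+1) => //.
  - move=> t; have [_ ->//] := prod_monic_size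
      (fun l => monic_of_monic ((@a l)^~ t%:C%C)) (fun l =>
        size_monic_of ((@a l)^~ t%:C%C)).
  - by move=> t; rewrite -Ws size_poly.
  - exact: (OpowM (Opow_cst s) (leq_Opow (leq0n 1) (Opow_var R))).
have [_ _ aWO] := eqOM alO WO.
apply: near_Opow aWO; near=> t.
have t0 : 0 < t by near: t; exact: nbhs_right_gt.
have td' : t < d' / (normc s + 1) by near: t; apply: nbhs_right_lt; rewrite divr_gt0.
rewrite ltr_pdivlMr// mulrC in td'.
have := QE' (s * t%:C%C) t%:C%C (le_lt_trans (st t t0) td') (le_lt_trans (tt t t0) td').
by rewrite /= !hornerD !hornerN !hornerM => ->; rewrite horner_prod.
Unshelve. all: by end_near. Qed.


(** The orders [K] are indexed by branches; [contact_order_unique] makes them functions of the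
    Puiseux series alone. *)
Lemma puiseux_contact_order L0 L (N : 'I_L -> nat) (Psi : 'I_L -> C -> C)
    (s : 'I_L0 -> {k : 'I_L & 'I_(N k)}) (psi : 'I_L0 -> C -> C) (K : 'I_L0 -> nat) :
  bijective s ->
  (forall l z, psi l z = branch (N (tag (s l))) (Psi (tag (s l))) (tagged (s l)) z) ->
  (forall k, analytic_at0 (Psi k) /\ Psi k 0 = 0) ->
  (forall l, contact_order (psi l) (K l)) ->
  exists kappa : 'I_L -> nat, (forall l, K l = kappa (tag (s l))) /\
    forall k j, (j < N k)%N -> contact_order (branch (N k) (Psi k) j) (kappa k).
Proof.
move=> [s' sK s'K] psiE Psia cK.
have cbr l k (j : 'I_(N k)) : s l = Tagged (fun k => 'I_(N k)) j ->
    contact_order (branch (N k) (Psi k) j) (K l).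
  move=> sl; have := cK l; rewrite (_ : psi l = branch (N k) (Psi k) j)//.
  by apply/funext => z; rewrite psiE sl.
have KE l l' k (j j' : 'I_(N k)) : s l = Tagged (fun k => 'I_(N k)) j ->
    s l' = Tagged (fun k => 'I_(N k)) j' -> K l = K l'.
  move=> sl sl'; have [Pa P0] := Psia k;
    have N0 : (0 < N k)%N := leq_ltn_trans (leq0n _) (ltn_ord j).
  by apply/eqP; rewrite eqn_leq (contact_order_unique N0 Pa P0 (cbr _ _ _ sl') (cbr _ _ _
    sl))
    (contact_order_unique N0 Pa P0 (cbr _ _ _ sl) (cbr _ _ _ sl')).
(* The order of branch 0 represents the factor; the default 0 is taken only when the factor has no
   branch. *)
pose kappa k := if insub 0%N is Some j then K (s' (Tagged (fun k =>
  'I_(N k)) (j : 'I_(N k)))) else 0%N.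
have kappaE l k (j : 'I_(N k)) : s l = Tagged (fun k => 'I_(N k)) j -> K l = kappa k.
  move=> sl; rewrite /kappa; case: insubP => [j0 _ _|]; last first.
    by rewrite -leqNgt leqn0 => /eqP N0; move: (ltn_ord j); rewrite {2}N0.
  by apply: KE sl _; rewrite s'K.
exists kappa; split=> [l|k j jN].
  by apply: (kappaE l _ (tagged (s l))); case: (s l).
rewrite -(kappaE (s' (Tagged (fun k => 'I_(N k)) (Ordinal jN))) k (Ordinal jN)) ?s'K//.
by have := cbr (s' (Tagged (fun k => 'I_(N k)) (Ordinal jN))) k (Ordinal jN);
  rewrite s'K; apply.
Qed.

End Germs.

Theorem proposition4p5 (R : realType) (m n : nat) (p : {poly {poly R[i]}})
    (L0 : nat) (psi : 'I_L0 -> R[i] -> R[i]) (K : 'I_L0 -> nat)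
    (V : set (R[i]^o * R[i]^o)) :
  assumption_A1 m n p ->
  branches m n (reflection m n p) psi ->
  open V -> V (1, 1) ->
  (forall z, V z ->
     (reflection m n p).[z.1, z.2] = 0 <-> exists l, z.1 = psi l z.2) ->
  (forall l, contact_order (psi l) (K l)) ->
  exists N : nat,
    intersection_multiplicity p (reflection m n p) 1 1 N /\
    (N <= \sum_(i < L0) \sum_(j < L0) minn (K i) (K j))%N.
Proof.
move=> HA [L [N [Psi [s [[alpha [qf [alan al0 qE qfP]]] sbij psiE]]]]] _ _ _ cK.
have [psize psizeY] := A1_bidegree HA.
set pt := reflection m n p in qE *.
have ptsize : (size pt <= m.+1)%N := size_reflection m n p.
have ptsizeY : (sizeY pt <= n.+1)%N := sizeY_reflection m n p.
set Q := mobius 'i m n pt; set P := mobius 'i m n p.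
have Psia k : analytic_at0 (Psi k) /\ Psi k 0 = 0 by have [_ _ []] := qfP k.
have [kappa [KE kappaP]] := puiseux_contact_order sbij psiE Psia cK.
have wp k : weierstrass_polynomial (qf k) (N k) by have [] := qfP k.
pose a k := sval (cid (wp k)).
have aan k : forall j, analytic_at0 (a k j) /\ a k j 0 = 0 := (svalP (cid (wp k))).1.
have aE k := (svalP (cid (wp k))).2.
have QE : \forall w \near ((0, 0) : R[i]^o * R[i]^o),
    Q.[w.1, w.2] = alpha w.1 w.2 * \prod_k (monic_of ((a k)^~ w.2)).[w.1].
  have aE' : \forall w \near ((0, 0) : R[i]^o * R[i]^o), forall k,
      qf k w.1 w.2 = w.1 ^+ N k + \sum_(j < N k) a k j w.2 * w.1 ^+ j.
    exact: filter_forall aE.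
  near=> w.
  have i2 : 0 < 2^-1 :> R by rewrite invr_gt0.
  have [w1 w2] : normc w.1 <= 2^-1 /\ normc w.2 <= 2^-1 by near: w; exact: near00_small.
  have qfE k : qf k w.1 w.2 = w.1 ^+ N k + \sum_(j < N k) a k j w.2 * w.1 ^+ j.
    by move: k; near: w.
  have nz (z : R[i]) : normc z <= 2^-1 -> 1 - 'i * z != 0.
    move=> /normc_1iw/andP[+ _]; apply: contraTneq => ->.
    by rewrite normc0 -ltNge invr_gt0.
  rewrite horner_mobius_div ?nz//.
  have -> : (1 - 'i * w.1) ^+ m * (1 - 'i * w.2) ^+ n *
      pt.[(1 + 'i * w.1) / (1 - 'i * w.1), (1 + 'i * w.2) / (1 - 'i * w.2)] =
      alpha w.1 w.2 * \prod_k qf k w.1 w.2 by near: w; exact: qE.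
  by congr (_ * _); apply: eq_bigr => k _; rewrite horner_monic_of qfE.
have [c c0 cIm] : exists2 c : R, 0 < c & \forall t \near 0^'+, forall k,
    0 < t -> forall w, (monic_of ((a k)^~ t%:C%C)).[w] = 0 -> c * t ^+ kappa k <=
      complex.Im w.
  apply: (@near0_uniform R L (fun k c t => 0 < t -> forall w,
     (monic_of ((a k)^~ t%:C%C)).[w] = 0 -> c * t ^+ kappa k <= complex.Im w)).
    move=> k c c' t cc' h t0 w /(h t0 w); apply: le_trans.
    by rewrite ler_wpM2r// exprn_ge0// ltW.
  move=> k; have [_ _ puis] := qfP k.
  have [c c0 h] := weierstrass_roots_Im (aan k) (aE k) puis (kappaP k).
  by exists c => //; apply: filterS h => t h _.
have {}cIm : \forall t \near 0^'+, forall k w,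
    (monic_of ((a k)^~ t%:C%C)).[w] = 0 -> c * t ^+ kappa k <= complex.Im w.
  near=> t => k w; have t0 : 0 < t by near: t; exact: nbhs_right_gt.
  by move: k {w} (w) t0; near: t; apply: filterS cIm => t h k w t0; exact: h.
set D := (\sum_(i < L0) _)%N.
(* Grouped by factors, the branches contribute N k * N k' equal terms for each pair (k, k'). *)
have DE : D = (\sum_k \sum_k' (N k * N k' * minn (kappa k) (kappa k')))%N.
  transitivity (\sum_(i < L0) \sum_(j < L0) minn (kappa (tag (s i))) (kappa (tag (s j))))%N.
    by apply: eq_bigr => i _; apply: eq_bigr => j _; rewrite !KE.
  transitivity (\sum_(l < L0) \sum_k' N k' * minn (kappa (tag (s l))) (kappa k'))%N.
    apply: eq_bigr => l _.
    exact: (sum_tagged (fun k' => minn (kappa (tag (s l))) (kappa k')) sbij).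
  rewrite (sum_tagged (fun k => \sum_k' N k' * minn (kappa k) (kappa k'))%N sbij).
  by apply: eq_bigr => k _; rewrite big_distrr/=; apply: eq_bigr => k' _; rewrite mulnA.
have [C0 C00 low] := resultant_lower_bound (normc_mobius_reflection m n p) alan al0 QE
  aan c0 cIm.
have p0 : p != 0 by rewrite -size_poly_eq0 psize.
have psize' : (size p <= m.+1)%N by rewrite psize.
have psizeY' : (sizeY p <= n.+1)%N by rewrite psizeY.
have [k0 bound] := local_multiplicity_bound p0 (A1_coprime HA) psize' psizeY' ptsize
  ptsizeY.
(* Precision [k0] keeps [W] in the local ideal, and D + 1 keeps the coefficients of the determinant
   up to index D. *)
pose k := maxn k0 D.+1.
have k_gt0 : (0 < k)%N by rewrite leq_max orbT.
have [al [W [al00 /andP[Wm /eqP Ws] QW aW]]] :=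
  germ_factorization_trunc alan QE (fun k j => (aan k j).1) k_gt0.
(* In degree 0 the germ of [Q] would be alpha, a unit, whereas the reflection vanishes at (1, 1)
   together with [p]. The successor form is what [horner_mx] expects. *)
have [L' NE] : exists L', (\sum_k N k)%N = L'.+1.
  exists (\sum_k N k).-1; rewrite prednK// lt0n; apply/negP => /eqP N0.
  have := A1_singular HA.
  have nk k' : N k' = 0%N by apply/eqP; rewrite -leqn0 -N0 (bigD1 k')//= leq_addr.
  have [e e0 Qe] := near00C_ball QE.
  have := Qe 0 0; rewrite normc0 /= => /(_ e0 e0).
  rewrite big1 ?mulr1 => [|k' _]; last first.
    rewrite horner_monic_of big1 => [|j _]; first by rewrite addr0 nk expr0.
    have Nk0 : (0 < N k')%N := leq_ltn_trans (leq0n _) (ltn_ord j).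
    by rewrite nk in Nk0.
  move=> Q0 p11; move: al0; rewrite -Q0 mobius00//.
  rewrite (reflectionE (A1_bidegree HA)) ?oner_eq0// !expr1n !mul1r.
  by rewrite !rmorph1 invr1 p11 rmorph0 eqxx.
rewrite NE in Ws.
(* Otherwise the determinant would be O(t^(D+1)) for [W], hence also for the untruncated product
   [A t], against the lower bound for the resultant. *)
have [d dD detd] : exists2 d, (d <= D)%N & (\det (horner_mx (companion L'.+1 W) P))`_d != 0.
  have [//|noD] := pselect (exists2 d, (d <= D)%N & (\det (horner_mx (companion L'.+1 W)
    P))`_d != 0).
  have : Opow D.+1 (fun t : R => (\det (horner_mx (companion L'.+1 W) P)).[t%:C%C]).
    apply: Opow_low_coef => i iD; apply/eqP/negPn/negP => di.
    by apply: noD; exists i.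
  pose A (t : R) := \prod_k monic_of ((a k)^~ t%:C%C).
  pose Pt (t : R) := map_poly (horner_eval t%:C%C) P.
  have Am (t : R) : A t \is monic /\ size (A t) = L'.+2.
    have [-> ->] := prod_monic_size (fun k' => monic_of_monic ((a k')^~ t%:C%C))
      (fun k' => size_monic_of ((a k')^~ t%:C%C)).
    by rewrite NE.
  have [_ _ detA] := eqO_det (eqO_horner_mx P (eqO_companion (n := L'.+1) aW)).
  have detW (t : R) : (\det (horner_mx (companion L'.+1 W) P)).[t%:C%C] =
      \det (horner_mx (companion L'.+1 (map_poly (horner_eval t%:C%C) W)) (Pt t)).
    rewrite -map_companion -map_horner_mx det_map_mx.
    by [].
  move=> detO.
  have {}detO : Opow D.+1 (fun t : R => \det (horner_mx (companion L'.+1 (A t)) (Pt t))).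
    apply: (eq_Opow _ (OpowD (leq_Opow (leq_maxr _ _) detA) detO)) => t.
    by rewrite detW subrK.
  exfalso; apply: (Opow_lower_bound C00 _ detO).
  apply: filterS low => t low.
  pose rs k' := sval (closed_field_poly_normal (monic_of ((a k')^~ t%:C%C))).
  have rsE k' : monic_of ((a k')^~ t%:C%C) = \prod_(r <- rs k') ('X - r%:P).
    have := svalP (closed_field_poly_normal (monic_of ((a k')^~ t%:C%C))).
    by rewrite -/(rs k') (monicP (monic_of_monic _)) scale1r.
  rewrite DE (_ : \det _ = \prod_k' \prod_(r <- rs k') P.[r, t%:C%C]); first exact: low.
  have [At1 At2] := Am t.
  rewrite (det_horner_companion _ (rs := rs) At1 At2); last first.
    by apply: eq_bigr => k' _; exact: rsE.
  by apply: eq_bigr => k' _; apply: eq_bigr => r _; rewrite hornerXY_map.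
have [||M [IM Md]] := bound L' al W d Wm Ws _ _ detd.
- by rewrite al00.
- by move=> i j ij; apply: QW; rewrite (leq_trans ij)// leq_maxl.
by exists M; split=> //; exact: leq_trans Md dD.
Unshelve. all: by end_near. Qed.
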